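(* Let $n \ge 2$ be even and let $\mathbf{X}_1,\dots,\mathbf{X}_n$ be independent random $d\times d$ real symmetric matrices, all of whose eigenvalues lie in $[0,1]$, with common mean $\mathbf{M}=\mathbb{E}\,\mathbf{X}_i$ and common variance $\mathbf{V}=\mathbb{E}(\mathbf{X}_i-\mathbf{M})^2$. Let $\overline{\mathbf{X}}_n=\frac1n\sum_{i=1}^n\mathbf{X}_i$ be the sample average and let $$\mathbf{V}_n^*=\frac1n\left((\mathbf{X}_1-\mathbf{X}_2)^2+(\mathbf{X}_3-\mathbf{X}_4)^2+\dots+(\mathbf{X}_{n-1}-\mathbf{X}_n)^2\right)$$ be the paired variance estimator. Then, for any $\alpha\in(0,1)$, $$\mathbb{P}\left(\lambda_{\max}\left(\overline{\mathbf{X}}_n-\mathbf{M}\right)\ge D_n\right)\le\alpha,$$ where $$D_n=\frac{\log\frac{nd}{(n-1)\alpha}}{3n}+\sqrt{\frac{2\,\|\mathbf{V}_n^*\|\,\log\frac{nd}{(n-1)\alpha}}{n}}+\left(\sqrt{\frac53}+1\right)\frac{\sqrt{\left(\log\frac{nd}{(n-1)\alpha}\right)\left(\log\frac{2nd}{\alpha}\right)}}{n}.$$ Further, if $\mathbf{X}_1,\mathbf{X}_2,\dots$ are i.i.d., then $$\lim_{n\to\infty}\sqrt{n}\,D_n=\sqrt{2\log(d/\alpha)\,\|\mathbf{V}\|}\quad\text{almost surely}.$$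
   Context: $\lambda_{\max}$ denotes the largest eigenvalue of a real symmetric matrix and $\|\cdot\|$ the spectral norm (largest absolute value of the eigenvalues). In the asymptotic statement, $\mathbf{X}_1,\mathbf{X}_2,\dots$ is an infinite i.i.d. sequence with the stated eigenvalue bounds, mean $\mathbf{M}$ and variance $\mathbf{V}$; $D_n$ is computed from the first $n$ matrices, and $n\to\infty$ along even integers, with $\alpha$ and $d$ fixed. *)

(* Defs.v *)
From HB Require Import structures.
From mathcomp Require Import all_boot all_order all_algebra.
From mathcomp Require Import all_classical all_reals all_analysis.

Set Implicit Arguments.
Unset Strict Implicit.
Unset Printing Implicit Defensive.

Import Order.TTheory GRing.Theory Num.Theory.
Import numFieldNormedType.Exports.

Local Open Scope classical_set_scope.
Local Open Scope ring_scope.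

(* For A symmetric and 0 < d, the set of real eigenvalues is finite and
   nonempty, so the two suprema below are attained. *)
Definition eigenvalues (R : realType) (d : nat) (A : 'M[R]_d) : set R :=
  [set a | eigenvalue A a].

Definition lambda_max (R : realType) (d : nat) (A : 'M[R]_d) : R :=
  sup (eigenvalues A).

Definition spectral_norm (R : realType) (d : nat) (A : 'M[R]_d) : R :=
  sup [set `|a| | a in eigenvalues A].

(* The Borel sigma-algebra on matrices, as the one generated by the entries. *)
Definition mx_measurable (R : realType) (d : nat) : set (set 'M[R]_d) :=
  <<s \bigcup_(ij in [set: 'I_d * 'I_d])
        preimage_set_system [set: 'M[R]_d] (fun A => A ij.1 ij.2) measurable >>.

Section random_matrices.
Context {R : realType} {disp : measure_display} {T : measurableType disp}.
Variables (P : probability T R) (d : nat).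
Implicit Types X : T -> 'M[R]_d.

Definition random_mx X : Prop :=
  forall B, mx_measurable B -> measurable (X @^-1` B).

Definition mx_expectation X : 'M[R]_d :=
  \matrix_(i, j) fine ('E_P[fun w => X w i j])%E.

Definition mx_independent (I : set nat) (X : nat -> T -> 'M[R]_d) : Prop :=
  forall (s : seq nat) (B : nat -> set 'M[R]_d),
    uniq s -> (forall i, i \in s -> I i) ->
    (forall i, i \in s -> mx_measurable (B i)) ->
    P (\bigcap_(i in [set` s]) (X i @^-1` B i)) =
    (\prod_(i <- s) P (X i @^-1` B i))%E.

Definition mx_identically_distributed (X : nat -> T -> 'M[R]_d) : Prop :=
  forall (i j : nat) (B : set 'M[R]_d), mx_measurable B ->
    P (X i @^-1` B) = P (X j @^-1` B).

Definition sample_hypotheses (I : set nat) (X : nat -> T -> 'M[R]_d)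
    (M V : 'M[R]_d) : Prop :=
  [/\ forall i, I i -> random_mx (X i),
      forall i, I i -> forall w, (X i w)^T = X i w,
      forall i, I i -> forall w a, eigenvalue (X i w) a -> 0 <= a <= 1,
      forall i, I i -> mx_expectation (X i) = M /\
                       mx_expectation (fun w => (X i w - M) ^+ 2) = V
    & mx_independent I X].

End random_matrices.

Section statistics.
Context {R : realType} {d : nat}.
Implicit Types (x : nat -> 'M[R]_d) (n : nat) (alpha : R).

(* Samples are numbered from 0: the first n matrices are x 0, ..., x n.-1. *)
Definition sample_average n x : 'M[R]_d := n%:R^-1 *: \sum_(i < n) x i.

Definition paired_variance n x : 'M[R]_d :=
  n%:R^-1 *: \sum_(i < n./2) (x i.*2 - x i.*2.+1) ^+ 2.

Definition deviation_bound alpha n x : R :=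
  let L := ln (n%:R * d%:R / ((n%:R - 1) * alpha)) in
  L / (3 * n%:R)
  + Num.sqrt (2 * spectral_norm (paired_variance n x) * L / n%:R)
  + (Num.sqrt (5 / 3) + 1)
    * (Num.sqrt (L * ln (2 * n%:R * d%:R / alpha)) / n%:R).

End statistics.

(* Main.v *)
(** For A symmetric put T_N(A) = (1 + A/N)^N, with N a power of two.  Iterating
    tr(W^2) <= tr(W W^T) gives tr((XY)^N) <= tr(X^N Y^N) for symmetric X, Y,
    whence the approximate Golden-Thompson inequality
    tr T_N(A + B) <= tr(T_N(A) T_N(B)) + O(1/N).  As all summands have the same
    variance bound v, peeling off independent centred summands Y with spectrum
    in [-1, 1] one at a time loses nothing: E T_N(tY) <= 1 + (e^t - 1 - t) v, so
    Markov's inequality and N -> oo give, for the sum S of m of them,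
    P(lambda_max(S) >= s) <= d e^(-ts) (1 + (e^t - 1 - t) v)^m, and optimising
    in t yields P(lambda_max(S) >= sqrt(2 m v L) + L/3) <= d e^(-L).

    This is applied to X_i - M, with v = ||V||, and to
    2V - (X_(2i-1) - X_(2i))^2, whose mean square is at most 2V.  The second
    application bounds ||V|| - ||V_n^*|| by a quadratic inequality in
    sqrt ||V||; solving it and substituting in the first application gives
    D_n.  The same tail bound for both signs, with Borel-Cantelli, gives
    ||V_n^*|| -> ||V|| almost surely, hence the limit of sqrt(n) D_n. *)
Require Import Defs.
From HB Require Import structures.
From mathcomp Require Import all_boot all_order all_algebra.
From mathcomp Require Import all_classical all_reals all_analysis.
From mathcomp Require Import measurable_realfun complex.
From mathcomp Require Import ring lra.

Set Implicit Arguments.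
Unset Strict Implicit.
Unset Printing Implicit Defensive.

Import Order.TTheory GRing.Theory Num.Theory.
Import numFieldNormedType.Exports.

Local Open Scope classical_set_scope.
Local Open Scope ring_scope.

(** * Symmetric matrices and their extreme eigenvalues *)

(** Replacing the exponential by the polynomials T_N keeps the argument inside polynomial calculus:
    values at a symmetric matrix are given by [horner_mx], and order and trace bounds are read off
    the spectrum. The price is the O(1/N) error, whose constant depends on t and on the number of
    summands; hence N -> oo is taken with both fixed, before t is optimised. Two further obstacles
    shape the proof. Markov's inequality and the union bound need measurable events, so extreme
    eigenvalues have to be expressed through traces of powers, which are polynomials in the entries.
    And independence is given for events on finitely many X_i, whereas the peeling step needs E(UV)
    = E(U) E(V) for matrix functions of disjoint groups of the X_i; sigma-algebras generated by such
    groups bridge the gap. *)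

Definition qform (R : pzRingType) (d : nat) (A : 'M[R]_d) (v : 'rV[R]_d) : R :=
  (v *m A *m v^T) 0 0.

Lemma horner_mx_conj_diag (F : fieldType) (n : nat) (P : 'M[F]_n.+1)
    (D : 'rV[F]_n.+1) (p : {poly F}) : P \in unitmx ->
  horner_mx (invmx P *m diag_mx D *m P) p =
  invmx P *m diag_mx (map_mx (horner p) D) *m P.
Proof. by move=> uP; rewrite horner_mx_uconjC // horner_mx_diag. Qed.

Section spectral_decomposition.
Context {R : realFieldType} {C : numClosedFieldType}.
Variables (f : {rmorphism R -> C}) (re : C -> R).
Hypothesis f_real : forall x, f x \is Num.real.
Hypothesis reK : forall z, z \is Num.real -> f (re z) = z.
Hypothesis f_le : {mono f : x y / x <= y}.

(** Over the closed field C the symmetric A is hermitian, hence unitarily diagonalisable with real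
    spectrum. The conclusion keeps only what descends to R: eigenvalues, traces and quadratic forms
    of polynomials in A. The weight w i is the squared modulus of the i-th coordinate of v in the
    eigenbasis, the same for every p. *)
Lemma spectral_decomposition_in (n : nat) (A : 'M[R]_n.+1) :
  A^T = A ->
  exists a : 'I_n.+1 -> R,
    [/\ forall i, eigenvalue A (a i),
        forall p : {poly R}, \tr (horner_mx A p) = \sum_i p.[a i]
      & forall v, exists2 w : 'I_n.+1 -> R, forall i, 0 <= w i &
          forall p : {poly R},
            qform (horner_mx A p) v = \sum_i p.[a i] * w i].
Proof.
move=> symA.
pose AC := map_mx f A.
have fconj (x : R) : (f x)^* = f x by apply/CrealP/f_real.
have symAC : AC \is symmetricmx.
  apply/is_hermitianmxP; rewrite expr0 scale1r map_mx_id //.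
  by rewrite /AC map_trmx symA.
have realAC : AC \is a mxOver Num.real by apply/mxOverP => i j; rewrite mxE.
have /orthomx_spectralP := symmetric_normalmx symAC realAC.
have /mxOverP := hermitian_spectral_diag_real (realsym_hermsym symAC realAC).
have := spectral_unitarymx AC.
move: (spectralmx AC) (spectral_diag AC) => P D uP realD defAC.
have Punit := unitarymx_unit uP.
pose a i := re (D 0 i).
have faE i : f (a i) = D 0 i by rewrite /a reK.
have hornerAC (p : {poly R}) : map_mx f (horner_mx A p) =
    invmx P *m diag_mx (\row_i f p.[a i]) *m P.
  rewrite map_horner_mx -/AC defAC horner_mx_conj_diag //.
  congr (_ *m diag_mx _ *m _); apply/rowP => i.
  by rewrite !mxE -faE horner_map.
exists a; split.
- move=> i; rewrite -(eigenvalue_map f) -/AC.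
  apply/eigenvalueP; exists (row i P).
    rewrite [in LHS]defAC -row_mul -mulmxA mulKVmx // row_mul row_diag_mx.
    by rewrite -scalemxAl -rowE faE.
  apply/eqP => /(congr1 (mulmx^~ (invmx P))).
  rewrite -row_mul mulmxV // mul0mx => /rowP/(_ i).
  by rewrite !mxE eqxx => /eqP; rewrite oner_eq0.
- move=> p; apply: (fmorph_inj f).
  rewrite -trace_map_mx hornerAC mxtrace_mulC mulmxA mulmxV // mul1mx.
  by rewrite mxtrace_diag rmorph_sum; apply: eq_bigr => i _; rewrite mxE.
- move=> v; pose vC := map_mx f v.
  pose u := vC *m invmx P.
  have uconj i : (P *m vC^T) i 0 = (u 0 i)^*.
    rewrite /u (invmx_unitary uP) mxE [in RHS]mxE rmorph_sum.
    apply: eq_bigr => j _; rewrite !mxE rmorphM /= conjCK fconj mulrC //.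
  have u_ge0 i : 0 <= u 0 i * (u 0 i)^* by rewrite mul_conjC_ge0.
  exists (fun i => re (u 0 i * (u 0 i)^*)).
    by move=> i; rewrite -f_le rmorph0 reK ?ger0_real.
  move=> p; apply: (fmorph_inj f).
  have -> : f (qform (horner_mx A p) v) =
      (u *m diag_mx (\row_i f p.[a i]) *m (P *m vC^T)) 0 0.
    transitivity (map_mx f (v *m horner_mx A p *m v^T) 0 0).
      by rewrite [RHS]mxE.
    by rewrite !map_mxM hornerAC -map_trmx /u !mulmxA.
  rewrite mxE rmorph_sum; apply: eq_bigr => i _.
  rewrite uconj mul_mx_diag !mxE rmorphM /= reK ?ger0_real //.
  all: rewrite ?mul_conjC_ge0 // [X in X * _]mulrC -mulrA //.
Qed.

End spectral_decomposition.

Lemma spectral_decomposition (R : rcfType) (n : nat) (A : 'M[R]_n.+1) :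
  A^T = A ->
  exists a : 'I_n.+1 -> R,
    [/\ forall i, eigenvalue A (a i),
        forall p : {poly R}, \tr (horner_mx A p) = \sum_i p.[a i]
      & forall v, exists2 w : 'I_n.+1 -> R, forall i, 0 <= w i &
          forall p : {poly R},
            qform (horner_mx A p) v = \sum_i p.[a i] * w i].
Proof.
apply: (@spectral_decomposition_in R R[i]%C (real_complex R)
  (@complex.Re R)) => [x|z|x y].
- by rewrite complex_real.
- exact: RRe_real.
- by rewrite lecR.
Qed.

Section qform.
Context {R : comPzRingType} {d : nat}.
Implicit Types (A B : 'M[R]_d) (v : 'rV[R]_d).

Lemma qformD A B v : qform (A + B) v = qform A v + qform B v.
Proof. by rewrite /qform mulmxDr mulmxDl mxE. Qed.

Lemma qformN A v : qform (- A) v = - qform A v.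
Proof. by rewrite /qform mulmxN mulNmx mxE. Qed.

Lemma qformB A B v : qform (A - B) v = qform A v - qform B v.
Proof. by rewrite qformD qformN. Qed.

Lemma qformZ a A v : qform (a *: A) v = a * qform A v.
Proof. by rewrite /qform -scalemxAr -scalemxAl mxE. Qed.

Lemma qform0 v : qform 0 v = 0.
Proof. by rewrite /qform mulmx0 mul0mx mxE. Qed.

Lemma qform_eigenvector A a v : v *m A = a *: v -> qform A v = a * qform 1%:M v.
Proof. by rewrite /qform mulmx1 => ->; rewrite -scalemxAl mxE. Qed.

Lemma qformE A v : qform A v = \sum_i \sum_j A i j * (v 0 i * v 0 j).
Proof.
rewrite /qform mxE exchange_big; apply: eq_bigr => j _.
rewrite !mxE big_distrl; apply: eq_bigr => i _ /=.
by rewrite mulrAC mulrC.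
Qed.

Lemma qform_mul_sym A B v : A^T = A -> qform (A *m B *m A) v = qform B (v *m A).
Proof. by move=> symA; rewrite /qform trmx_mul symA !mulmxA. Qed.

End qform.

Section qform_order.
Context {R : realFieldType} {d : nat}.
Implicit Types (A B : 'M[R]_d) (v : 'rV[R]_d).

Lemma qform1E v : qform 1%:M v = \sum_i v 0 i ^+ 2.
Proof. by rewrite /qform mulmx1 mxE; apply: eq_bigr => i _;
  rewrite mxE expr2. Qed.

Lemma qform1_ge0 v : 0 <= qform 1%:M v.
Proof. by rewrite qform1E sumr_ge0 // => i _; rewrite sqr_ge0. Qed.

Lemma qform1_gt0 v : v != 0 -> 0 < qform 1%:M v.
Proof.
move=> v0; rewrite lt_neqAle qform1_ge0 andbT eq_sym.
apply: contra v0; rewrite qform1E psumr_eq0; last by move=> i; rewrite sqr_ge0.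
move=> /allP h; apply/eqP/rowP => i; rewrite mxE; apply/eqP.
by rewrite -sqrf_eq0; apply: h; rewrite mem_index_enum.
Qed.

(** The Loewner order of symmetric matrices. *)
Definition mxle A B := forall v, qform A v <= qform B v.

Lemma eigenvalue_mxle A c a : mxle A c%:M -> eigenvalue A a -> a <= c.
Proof.
move=> Ac /eigenvalueP[v vA v0]; have := Ac v.
rewrite -[c%:M]scalemx1 qformZ (qform_eigenvector vA).
by rewrite ler_pM2r // qform1_gt0.
Qed.

Lemma eigenvalue_mxge A c a : mxle c%:M A -> eigenvalue A a -> c <= a.
Proof.
move=> Ac /eigenvalueP[v vA v0]; have := Ac v.
rewrite -[c%:M]scalemx1 qformZ (qform_eigenvector vA).
by rewrite ler_pM2r // qform1_gt0.
Qed.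

End qform_order.

Lemma affine_expE (R : comNzRingType) (n : nat) (A : 'M[R]_n.+1) (b c : R)
    (N : nat) :
  (b%:M + c *: A) ^+ N = horner_mx A ((b%:P + c *: 'X) ^+ N).
Proof. by rewrite rmorphXn rmorphD /= linearZ /= horner_mx_C horner_mx_X. Qed.

Section symmetric.
Context {R : rcfType} {n : nat}.
Implicit Types (A B : 'M[R]_n.+1) (v : 'rV[R]_n.+1) (p q : {poly R}).

(** The weights of the spectral decomposition are shared by all polynomials, so a scalar inequality
    on the spectrum transfers term by term. *)
Lemma mxle_horner A p q : A^T = A ->
  (forall a, eigenvalue A a -> p.[a] <= q.[a]) ->
  mxle (horner_mx A p) (horner_mx A q).
Proof.
move=> /spectral_decomposition[a [eig_a _ dec]] pq v.
have [w w0 h] := dec v; rewrite !h.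
by apply: ler_sum => i _; rewrite ler_wpM2r // pq.
Qed.

Lemma mxle_eigenvalues A b c : A^T = A ->
  (forall a, eigenvalue A a -> b <= a <= c) -> mxle b%:M A /\ mxle A c%:M.
Proof.
move=> symA bd; rewrite -[X in mxle _ X /\ mxle X _](horner_mx_X A).
rewrite -!(horner_mx_C A).
by split; apply: mxle_horner => // a /bd /andP[]; rewrite hornerC hornerX.
Qed.

(** If v is an eigenvector for x, the form of (X - x)^2 vanishes at v. Being the sum of the (a i -
    x)^2 w i, it forces w i = 0 whenever a i differs from x; if x were none of the a i, all weights
    would vanish, although they sum to |v|^2 > 0. *)
Lemma spectrum_finite A : A^T = A ->
  exists2 a : 'I_n.+1 -> R,
    forall x, eigenvalue A x <-> exists i, x = a i &
    forall p, \tr (horner_mx A p) = \sum_i p.[a i].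
Proof.
move=> /spectral_decomposition[a [eig_a tr_a dec]]; exists a => // x.
split=> [/eigenvalueP[v vA v0]|[i ->] //]; apply: contrapT => nx.
have [w w0 h] := dec v.
have sum_w : \sum_i w i = qform 1%:M v.
  by rewrite -(horner_mx_C A) h; apply: eq_bigr => i _; rewrite hornerC mul1r.
suff w_eq0 i : w i = 0.
  by move: (qform1_gt0 v0); rewrite -sum_w big1 ?ltxx.
have /eqP := h (('X - x%:P) ^+ 2).
rewrite rmorphXn rmorphB /= horner_mx_X horner_mx_C expr2 -mulmxE /qform mulmxA.
have vAx : v *m (A - x%:M) = 0 by rewrite mulmxBr vA mul_mx_scalar subrr.
rewrite vAx !mul0mx mxE eq_sym.
rewrite psumr_eq0 => [|j _]; last by rewrite mulr_ge0 // !hornerE sqr_ge0.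
move=> /allP/(_ i); rewrite mem_index_enum => /(_ isT).
rewrite !hornerE mulf_eq0 => /orP[|/eqP//].
rewrite sqrf_eq0 subr_eq0 => /eqP xi; case: nx.
by exists i.
Qed.

End symmetric.

Lemma bernoulli_ineq (R : realDomainType) (r : R) k :
  0 <= r -> 1 + k%:R * (r - 1) <= r ^+ k.
Proof.
move=> r0; elim: k => [|k IH]; first by rewrite mul0r addr0 expr0.
apply: (@le_trans _ _ ((1 + k%:R * (r - 1)) * r)); last first.
  by rewrite exprSr ler_wpM2r.
rewrite -subr_ge0.
have -> : (1 + k%:R * (r - 1)) * r - (1 + k.+1%:R * (r - 1)) =
    k%:R * (r - 1) ^+ 2 by rewrite -natr1; ring.
by rewrite mulr_ge0 // sqr_ge0.
Qed.

Section extreme_eigenvalues.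
Context {R : realType} {n : nat}.
Implicit Types (A B : 'M[R]_n.+1) (v : 'rV[R]_n.+1).

Lemma sup_attained (S : set R) x : S x -> (forall y, S y -> y <= x) -> sup S =
  x.
Proof.
move=> Sx Sub; apply/le_anti/andP; split.
  by apply: ge_sup => //; exists x.
by apply: ub_le_sup => //; exists x.
Qed.

Lemma lambda_max_attained A : A^T = A ->
  eigenvalue A (lambda_max A) /\
  (forall a, eigenvalue A a -> a <= lambda_max A).
Proof.
move=> /spectrum_finite[a eigE _].
pose i0 := [arg max_(i > ord0) a i]%O.
have max_i i : a i <= a i0.
  by rewrite /i0; case: arg_maxP => // j _; apply.
have eig0 : eigenvalue A (a i0) by apply/eigE; exists i0.
have le0 x : eigenvalue A x -> x <= a i0 by move=> /eigE[i ->].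
by rewrite /lambda_max (sup_attained (x := a i0)).
Qed.

Lemma spectral_norm_attained A : A^T = A ->
  (exists2 a, eigenvalue A a & spectral_norm A = `|a|) /\
  (forall a, eigenvalue A a -> `|a| <= spectral_norm A).
Proof.
move=> /spectrum_finite[a eigE _].
pose i0 := [arg max_(i > ord0) `|a i|]%O.
have max_i i : `|a i| <= `|a i0|.
  by rewrite /i0; case: arg_maxP => // j _; apply.
have eig0 : eigenvalue A (a i0) by apply/eigE; exists i0.
have le0 x : eigenvalue A x -> `|x| <= `|a i0| by move=> /eigE[i ->].
rewrite /spectral_norm (sup_attained (x := `|a i0|)).
- by split=> //; exists (a i0).
- by exists (a i0).
- by move=> _ [x /= /le0 + <-].
Qed.

Lemma spectral_norm_ge0 A : A^T = A -> 0 <= spectral_norm A.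
Proof. by move=> /spectral_norm_attained[[a _ ->] _]. Qed.

Lemma mxle_lambda_max A : A^T = A -> mxle A (lambda_max A)%:M.
Proof.
move=> symA; have [_ le_max] := lambda_max_attained symA.
rewrite -[X in mxle X _](horner_mx_X A) -(horner_mx_C A).
by apply: mxle_horner => // a /le_max; rewrite hornerC hornerX.
Qed.

Lemma mxle_spectral_norm A : A^T = A -> mxle A (spectral_norm A)%:M.
Proof.
move=> symA; have [_ le_max] := spectral_norm_attained symA.
rewrite -[X in mxle X _](horner_mx_X A) -(horner_mx_C A).
apply: mxle_horner => // a /le_max; rewrite hornerC hornerX.
exact/le_trans/ler_norm.
Qed.

Lemma spectral_norm_le A c : A^T = A -> mxle (- c)%:M A -> mxle A c%:M ->
  spectral_norm A <= c.
Proof.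
move=> /spectral_norm_attained[[a eig ->] _] lo up.
by rewrite ler_norml (eigenvalue_mxge lo) // (eigenvalue_mxle up).
Qed.

Lemma spectral_norm_psd A : A^T = A -> mxle 0 A -> spectral_norm A =
  lambda_max A.
Proof.
move=> symA psd; have [[a eig_a na] le_norm] := spectral_norm_attained symA.
have [eig_m le_max] := lambda_max_attained symA.
have eig_ge0 x : eigenvalue A x -> 0 <= x.
  by apply: eigenvalue_mxge; rewrite -scalemx1 scale0r.
apply/le_anti/andP; split; first by rewrite na ger0_norm ?eig_ge0 // le_max.
by rewrite (le_trans (ler_norm _)) // le_norm.
Qed.

Lemma lambda_max_le A c : A^T = A -> mxle A c%:M -> lambda_max A <= c.
Proof. by move=> /lambda_max_attained[eig _] up;
  rewrite (eigenvalue_mxle up). Qed.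

(** For a positive semidefinite A the norm is the largest eigenvalue, so one-sided control of A - B
    bounds it. This is why a one-sided tail for V - V_n^* suffices in the finite-sample bound. *)
Lemma spectral_norm_sub A B : A^T = A -> B^T = B -> mxle 0 A ->
  spectral_norm A <= spectral_norm B + lambda_max (A - B).
Proof.
move=> symA symB psdA; rewrite spectral_norm_psd //.
apply: lambda_max_le => // v.
have symAB : (A - B)^T = A - B by rewrite linearB /= symA symB.
have := mxle_spectral_norm symB v; have := mxle_lambda_max symAB v.
rewrite -[(_ + _)%:M]scalemx1 -[(lambda_max _)%:M]scalemx1.
by rewrite -[(spectral_norm _)%:M]scalemx1 !qformZ qformB; lra.
Qed.

Lemma lambda_maxZ A c : A^T = A -> 0 < c -> lambda_max (c *: A) =
  c * lambda_max A.
Proof.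
move=> symA c0; have symcA : (c *: A)^T = c *: A by rewrite linearZ /= symA.
apply/le_anti/andP; split.
  apply: lambda_max_le => // v; have := mxle_lambda_max symA v.
  rewrite -[(c * _)%:M]scalemx1 -[(lambda_max _)%:M]scalemx1 !qformZ -mulrA.
  by rewrite ler_pM2l.
rewrite -ler_pdivlMl //; apply: lambda_max_le => // v.
have := mxle_lambda_max symcA v.
rewrite -[(c^-1 * _)%:M]scalemx1 -[(lambda_max _)%:M]scalemx1 !qformZ -mulrA.
by rewrite ler_pdivlMl.
Qed.

Lemma lambda_max_shift A c : A^T = A ->
  lambda_max (A + c%:M) = lambda_max A + c.
Proof.
move=> symA;
  have symc : (A + c%:M)^T = A + c%:M by rewrite linearD /= symA tr_scalar_mx.
apply/le_anti/andP; split.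
  apply: lambda_max_le => // v; have := mxle_lambda_max symA v.
  rewrite -[(_ + c)%:M]scalemx1 -[(lambda_max _)%:M]scalemx1 -[c%:M]scalemx1.
  by rewrite qformD !qformZ; lra.
rewrite -lerBrDr; apply: lambda_max_le => // v.
have := mxle_lambda_max symc v.
rewrite -[(_ - c)%:M]scalemx1 -[(lambda_max _)%:M]scalemx1.
by rewrite -{1}[c%:M]scalemx1 qformD !qformZ; lra.
Qed.

Lemma mxtrace_horner_ge A (p : {poly R}) : A^T = A ->
  (forall a, eigenvalue A a -> 0 <= p.[a]) ->
  p.[lambda_max A] <= \tr (horner_mx A p).
Proof.
move=> symA p0; have [/[swap] _] := lambda_max_attained symA.
have [a eigE ->] := spectrum_finite symA.
move=> /eigE[i ->]; rewrite (bigD1 i) //= lerDl sumr_ge0 // => j _.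
by rewrite p0 //; apply/eigE; exists j.
Qed.

(* For [0 < b], the norm is at most [b] exactly when the traces of the even
   powers of [A / b] stay below the dimension; hence it is measurable. *)
Lemma spectral_norm_gtP A b : A^T = A -> 0 <= b ->
  b < spectral_norm A <->
  exists k, n.+1%:R * b ^+ (k.+1).*2 < \tr (A ^+ (k.+1).*2).
Proof.
move=> symA b0.
have trE k : \tr (A ^+ k) = \tr (horner_mx A ('X ^+ k)).
  by rewrite rmorphXn /= horner_mx_X.
have [[x eig_x nx] le_norm] := spectral_norm_attained symA.
have [a eigE tra] := spectrum_finite symA.
have even_pow (y : R) k : y ^+ k.*2 = `|y| ^+ k.*2.
  by rewrite -normrX ger0_norm // -muln2 exprM sqr_ge0.
split=> [bA|[k]]; last first.
  rewrite trE tra; apply: contraTT; rewrite -!leNgt => Ab.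
  have -> : n.+1%:R * b ^+ (k.+1).*2 = \sum_(i < n.+1) b ^+ (k.+1).*2.
    by rewrite sumr_const card_ord mulr_natl.
  rewrite ler_sum // => i _.
  rewrite hornerXn even_pow lerXn2r ?nnegrE //.
  by rewrite (le_trans _ Ab) // le_norm //; apply/eigE; exists i.
have tr_ge k : spectral_norm A ^+ k.*2 <= \tr (A ^+ k.*2).
  rewrite trE tra; have /eigE[i xi] := eig_x.
  rewrite (bigD1 i) //= hornerXn -xi nx -even_pow lerDl sumr_ge0 // => j _.
  by rewrite hornerXn -muln2 exprM sqr_ge0.
have [->|bn0] := eqVneq b 0.
  exists 0%N; rewrite expr0n /= mulr0.
  by apply: lt_le_trans (tr_ge 1%N); rewrite exprn_gt0 // (le_lt_trans b0).
have {bn0}b0 : 0 < b by rewrite lt_neqAle eq_sym bn0.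
pose r := spectral_norm A / b.
have r1 : 0 < r - 1 by rewrite subr_gt0 /r ltr_pdivlMr // mul1r.
(* Bernoulli's inequality makes r^(2k+2) exceed the dimension as soon as k (r - 1) does. *)
pose k := Num.bound (n.+1%:R / (r - 1)); exists k.
apply: lt_le_trans (tr_ge _).
rewrite -ltr_pdivlMr ?exprn_gt0 // -expr_div_n -/r.
have r0 : 0 <= r by lra.
apply: lt_le_trans (bernoulli_ineq (k.+1).*2 r0).
have : n.+1%:R / (r - 1) < k%:R by rewrite archi_boundP // divr_ge0 // ltW.
rewrite ltr_pdivrMr // => /lt_trans; apply.
rewrite ltr_pwDl // ler_wpM2r //; [exact: ltW|rewrite ler_nat].
by rewrite -addnn addSn leqW // leq_addr.
Qed.

End extreme_eigenvalues.

(** * A Golden-Thompson inequality *)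

Section trace_inequalities.
Context {R : realFieldType} {n : nat}.
Implicit Types (A B C W X Y : 'M[R]_n.+1).

Lemma mxtrace_mul_rowE A B : \tr (A * B) = \sum_i \sum_j A i j * B j i.
Proof. by apply: eq_bigr => i _; rewrite -mulmxE mxE. Qed.

Lemma mxtrace_expr_mulC A B N : \tr ((A * B) ^+ N) = \tr ((B * A) ^+ N).
Proof.
case: N => [//|N].
have shift : forall M, (A * B) ^+ M * A = A * (B * A) ^+ M.
  elim=> [|M IH]; first by rewrite !expr0 mul1r mulr1.
  by rewrite !exprSr !mulrA IH.
rewrite exprSr mulrA shift -!mulmxE mxtrace_mulC !mulmxE mulrA.
by rewrite -exprS.
Qed.

(** Twice the difference of the two sides is the sum of the (W i j - W j i)^2. *)
Lemma mxtrace_sqr_le W : \tr (W ^+ 2) <= \tr (W * W^T).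
Proof.
rewrite expr2 !mxtrace_mul_rowE.
have swap : \sum_i \sum_j W j i * W j i = \sum_i \sum_j W i j * W i j.
  by rewrite exchange_big.
have -> : \sum_i \sum_j W i j * W^T j i = \sum_i \sum_j W i j * W i j.
  by apply: eq_bigr => i _; apply: eq_bigr => j _; rewrite mxE.
rewrite -subr_ge0 -(@pmulr_rge0 _ 2) // mulrBr mulr2n mulrDl mul1r.
rewrite -{2}swap mulr_sumr -big_split -sumrB sumr_ge0 // => i _ /=.
rewrite mulr_sumr -big_split -sumrB sumr_ge0 // => j _ /=.
by rewrite (_ : _ - _ = (W i j - W j i) ^+ 2) ?sqr_ge0 //; ring.
Qed.

Lemma mxtrace_mul_le A B : A^T = A -> B^T = B ->
  \tr (A * B) <= (\tr (A ^+ 2) + \tr (B ^+ 2)) / 2.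
Proof.
move=> symA symB; rewrite !expr2 !mxtrace_mul_rowE -big_split mulr_suml.
apply: ler_sum => i _; rewrite -big_split mulr_suml; apply: ler_sum => j _ /=.
have -> : A j i = A i j by rewrite -[in RHS]symA mxE.
have -> : B j i = B i j by rewrite -[in RHS]symB mxE.
by have := sqr_ge0 (A i j - B i j); rewrite sqrrB; lra.
Qed.

Lemma trmx_expr A k : (A ^+ k)^T = A^T ^+ k.
Proof.
elim: k => [|k IH]; first by rewrite !expr0 trmx1.
by rewrite exprS exprSr -!mulmxE trmx_mul IH.
Qed.

(* Joint induction: the step for either inequality uses both at level [k]. *)
Lemma mxtrace_pow2_le k :
  (forall W, \tr (W ^+ (2 ^ k.+1)) <= \tr ((W * W^T) ^+ (2 ^ k))) /\
  (forall X Y, X^T = X -> Y^T = Y ->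
     \tr ((X * Y) ^+ (2 ^ k)) <= \tr (X ^+ (2 ^ k) * Y ^+ (2 ^ k))).
Proof.
elim: k => [|k [IHW IHXY]].
  by split=> [W|X Y _ _]; rewrite ?expr1 // mxtrace_sqr_le.
split=> [W|X Y symX symY].
  (* Apply the hypothesis to W^2, rotate one factor W cyclically to obtain (W W^T)(W^T W), and
     separate the powers by the second hypothesis. The arithmetic-geometric mean inequality
     finishes, since both resulting traces are equal. *)
  rewrite (expnS _ k.+1) exprM; apply: (le_trans (IHW _)).
  have -> : W ^+ 2 * (W ^+ 2)^T = W * (W * W^T * W^T).
    by rewrite trmx_expr !expr2 !mulrA.
  rewrite mxtrace_expr_mulC -!mulrA mulrA.
  have symP : (W * W^T)^T = W * W^T by rewrite -mulmxE trmx_mul trmxK.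
  have symQ : (W^T * W)^T = W^T * W by rewrite -mulmxE trmx_mul trmxK.
  apply: (le_trans (IHXY _ _ symP symQ)).
  apply: (le_trans (mxtrace_mul_le _ _)); rewrite ?trmx_expr ?symP ?symQ //.
  rewrite -!exprM -expnSr (mxtrace_expr_mulC W^T).
  by move: (\tr _) => t; lra.
(* The first hypothesis at W = X Y yields X Y Y X, which rotates cyclically to Y^2 X^2, a product to
   which the second one applies. *)
apply: (le_trans (IHW _)).
have -> : X * Y * (X * Y)^T = X * (Y ^+ 2 * X).
  by rewrite -[in LHS]mulmxE trmx_mul symX symY !mulmxE expr2 !mulrA.
rewrite mxtrace_expr_mulC -mulrA -expr2.
apply: (le_trans (IHXY _ _ _ _)); rewrite ?trmx_expr ?symX ?symY //.
by rewrite -!exprM -expnS -!mulmxE mxtrace_mulC.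
Qed.

(* The maximal absolute row sum, unlike the entrywise norms, is
   submultiplicative with value [1] at the identity, so the powers
   [(1 + A / N) ^+ N] stay bounded. *)
Definition row_bound A (c : R) := forall i, \sum_j `|A i j| <= c.

Lemma row_bound1 : row_bound 1 1.
Proof.
move=> i; rewrite (bigD1 i) //= big1 ?addr0 => [|j /negbTE ji].
  by rewrite !mxE eqxx normr1.
by rewrite !mxE eq_sym ji normr0.
Qed.

Lemma row_boundD A B a b :
  row_bound A a -> row_bound B b -> row_bound (A + B) (a + b).
Proof.
move=> Aa Bb i; apply: le_trans (lerD (Aa i) (Bb i)); rewrite -big_split.
by apply: ler_sum => j _; rewrite mxE ler_normD.
Qed.

Lemma row_boundZ A a c : 0 <= c -> row_bound A a -> row_bound (c *: A) (c * a).
Proof.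
move=> c0 Aa i; apply: le_trans (ler_wpM2l c0 (Aa i)); rewrite mulr_sumr.
by apply: ler_sum => j _; rewrite mxE normrM ger0_norm.
Qed.

Lemma row_bound_ge0 A a : row_bound A a -> 0 <= a.
Proof. by move=> /(_ ord0); apply: le_trans; apply: sumr_ge0. Qed.

Lemma row_boundM A B a b :
  row_bound A a -> row_bound B b -> row_bound (A * B) (a * b).
Proof.
move=> Aa Bb i; have b0 := row_bound_ge0 Bb.
apply: le_trans (ler_wpM2r b0 (Aa i)).
apply: (@le_trans _ _ (\sum_j \sum_k `|A i k| * `|B k j|)).
  apply: ler_sum => j _; rewrite -mulmxE mxE;
    apply: (le_trans (ler_norm_sum _ _ _)).
  by apply: ler_sum => k _; rewrite normrM.
rewrite exchange_big mulr_suml; apply: ler_sum => k _ /=.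
by rewrite -mulr_sumr ler_wpM2l.
Qed.

Lemma row_boundX A a k : row_bound A a -> row_bound (A ^+ k) (a ^+ k).
Proof.
move=> Aa; elim: k => [|k IH]; first by rewrite !expr0; exact: row_bound1.
by rewrite !exprS; exact: row_boundM.
Qed.

Lemma row_bound_le A a b : a <= b -> row_bound A a -> row_bound A b.
Proof. by move=> ab Aa i; apply: (le_trans (Aa i)). Qed.

Lemma row_bound_exprB A B c e k : 1 <= c ->
  row_bound A c -> row_bound B c -> row_bound (A - B) e ->
  row_bound (A ^+ k - B ^+ k) (k%:R * e * c ^+ k).
Proof.
move=> c1 Ac Bc ABe; have e0 := row_bound_ge0 ABe.
elim: k => [|k IH].
  by rewrite !expr0 subrr !mul0r => i; rewrite big1 // => j _;
    rewrite mxE normr0.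
have -> : A ^+ k.+1 - B ^+ k.+1 = A ^+ k * (A - B) + (A ^+ k - B ^+ k) * B.
  by rewrite mulrBr mulrBl -!exprSr addrA subrK.
apply: row_bound_le (row_boundD (row_boundM (row_boundX k Ac) ABe)
  (row_boundM IH Bc)).
have ck : c ^+ k <= c ^+ k.+1 by rewrite ler_weXn2l.
rewrite -natr1 -[k%:R * e * _ * c]mulrA -exprSr.
have := ler_wpM2r e0 ck; lra.
Qed.

Lemma mxtrace_row_bound A a : row_bound A a -> `|\tr A| <= n.+1%:R * a.
Proof.
move=> Aa; apply: (le_trans (ler_norm_sum _ _ _)).
rewrite (_ : _ * a = \sum_(i < n.+1) a); last first.
  by rewrite sumr_const card_ord mulr_natl.
apply: ler_sum => i _; apply: le_trans (Aa i).
by rewrite (bigD1 i) //= lerDl sumr_ge0.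
Qed.

(** By cyclicity the trace is that of A B A, the sum of the values of the form B at the rows of A.
    In the peeling step [A ^+ 2] is T_N of the partial sum, a square because N is even, and B is the
    averaged factor. *)
Lemma mxtrace_sqr_mul_le A B c : A^T = A -> mxle B c%:M ->
  \tr (A ^+ 2 * B) <= c * \tr (A ^+ 2).
Proof.
move=> symA Bc.
have trE D : \tr (A ^+ 2 * D) = \sum_i qform D (row i A).
  rewrite expr2 -!mulmxE -mulmxA mxtrace_mulC; apply: eq_bigr => i _.
  rewrite /qform -row_mul tr_row symA !mxE; apply: eq_bigr => j _.
  by rewrite !mxE.
rewrite -[in leRHS](mulr1 (A ^+ 2)) !trE mulr_sumr; apply: ler_sum => i _.
by apply: le_trans (Bc _) _; rewrite -scalemx1 qformZ.
Qed.

End trace_inequalities.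

(** * Scalar bounds on (1 + x / N)^N and on the exponential *)

Lemma expD1n_le (R : realFieldType) (c y : R) N : 0 <= c -> `|y| <= 1 ->
  (c * y + 1) ^+ N <= 1 + N%:R * c * y + ((c + 1) ^+ N - 1 - N%:R * c) * y ^+ 2.
Proof.
move=> c0 y1;
  have y2 : y ^+ 2 <= 1 by rewrite -real_normK ?num_real // expr_le1.
case: N => [|[|N]]; first by rewrite !expr0; lra.
  by rewrite !expr1; lra.
rewrite !exprD1n 2![in leLHS]big_ord_recl 2![in leRHS]big_ord_recl /=.
rewrite !expr0 !bin0 !expr1 !bin1 !mulr1n.
set S := \sum_(i < N.+1) _; set S' := \sum_(i < N.+1) _.
(* S and S' are the binomial terms of degree at least 2 at y and at 1; each is compared through y^k
   <= y^2, valid for |y| <= 1. *)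
suff : S <= S' * y ^+ 2.
  rewrite /bump /= -[c * y *+ _]mulr_natl -[c *+ _]mulr_natl; lra.
rewrite mulr_suml; apply: ler_sum => i _; rewrite /bump /=.
rewrite mulrnAl lerMn2r exprMn; apply/orP; right.
rewrite ler_wpM2l ?exprn_ge0 //.
rewrite !add1n 2!exprS mulrA -expr2 -[leRHS]mulr1 ler_wpM2l ?sqr_ge0 //.
by rewrite (le_trans (ler_norm _)) // normrX exprn_ile1.
Qed.

Section exponential_bounds.
Context {R : realType}.
Implicit Types (x y t : R) (N : nat).

Lemma expD1n_le_expR x N : 0 <= x -> (0 < N)%N ->
  (1 + x / N%:R) ^+ N <= expR x.
Proof.
move=> x0 N0; have NR0 : 0 < N%:R :> R by rewrite ltr0n.
have -> : expR x = expR (x / N%:R) ^+ N.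
  by rewrite -expRM_natl mulrC divfK ?gt_eqF.
by rewrite lerXn2r ?nnegrE ?addr_ge0 ?divr_ge0 ?expR_ge0 ?expR_ge1Dx // ltW.
Qed.

(** Bennett's bound on e^(ty), uniformly in N: the quadratic coefficient (1 + t/N)^N - 1 - t is at
    most e^t - 1 - t. *)
Lemma expD1n_bennett t y N : (0 < N)%N -> 0 <= t -> `|y| <= 1 ->
  (1 + t * y / N%:R) ^+ N <= 1 + t * y + (expR t - 1 - t) * y ^+ 2.
Proof.
move=> N0 t0 y1; have NR0 : N%:R != 0 :> R by rewrite pnatr_eq0 -lt0n.
have c0 : 0 <= t / N%:R by rewrite divr_ge0.
have := expD1n_le N c0 y1; rewrite mulrAC addrC => /le_trans; apply.
rewrite [N%:R * _]mulrC divfK // lerD2l ler_wpM2r ?sqr_ge0 // !lerD2r addrC.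
exact: expD1n_le_expR.
Qed.

Lemma fact_ge_pow3 k : (2 * 3 ^ k <= (k.+2)`!)%N.
Proof.
elim: k => [|k IH] //; rewrite factS expnS mulnCA.
by rewrite leq_mul.
Qed.

(** Since (k+2)! >= 2 * 3^k, the tail of the exponential series is dominated by a geometric series
    of ratio t/3. The constant 1/3 in D_n originates here. *)
Lemma expR_bernstein t : 0 <= t -> t < 3 ->
  expR t - 1 - t <= t ^+ 2 / (2 * (1 - t / 3)).
Proof.
move=> t0 t3; set q := t / 3.
have q0 : 0 <= q by rewrite divr_ge0.
have q1 : 0 < 1 - q by rewrite subr_gt0 ltr_pdivrMr ?mul1r.
suff part k : series (exp_coeff t) k.+2 <=
    1 + t + t ^+ 2 / 2 * ((1 - q ^+ k) / (1 - q)).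
  rewrite lerBlDr lerBlDr addrC addrA; apply: limr_le.
    exact: is_cvg_series_exp_coeff.
  exists 2%N => // -[//|[//|k]] _.
  have : t ^+ 2 / 2 * ((1 - q ^+ k) / (1 - q)) <= t ^+ 2 / (2 * (1 - q)).
    rewrite invfM [leRHS]mulrA ler_wpM2l ?divr_ge0 ?sqr_ge0 //.
    by rewrite ler_pdivrMr // mulVf ?gt_eqF // gerBl exprn_ge0.
  by have := part k; move: (series _ _) => s; lra.
elim: k => [|k IH].
  rewrite !seriesSr /series /= big_geq // /exp_coeff /=.
  rewrite expr0 expr1 subrr.
  by rewrite mul0r mulr0 !divr1 add0r addr0.
rewrite seriesSr; apply: (le_trans (lerD IH (_ : _ <= t ^+ 2 / 2 * q ^+ k))).
  rewrite /exp_coeff /q expr_div_n /=.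
  have -> : t ^+ k.+2 = t ^+ 2 * t ^+ k by rewrite -exprD.
  rewrite -mulrA -[leRHS]mulrA ler_wpM2l ?sqr_ge0 //.
  rewrite [leRHS]mulrCA ler_wpM2l ?exprn_ge0 // -invfM lef_pV2.
  - by rewrite -natrX -natrM ler_nat fact_ge_pow3.
  - by rewrite posrE ltr0n fact_gt0.
  - by rewrite posrE mulr_gt0 // exprn_gt0.
rewrite -!addrA -mulrDr lerD2l lerD2l ler_wpM2l ?divr_ge0 ?sqr_ge0 //.
suff -> : (1 - q ^+ k) / (1 - q) + q ^+ k = (1 - q ^+ k.+1) / (1 - q) by [].
by rewrite exprS; field; rewrite gt_eqF.
Qed.

End exponential_bounds.

(** * Polynomial exponentials of symmetric matrices *)

Section pexp.
Context {R : realType} {n : nat}.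
Implicit Types (A B Y : 'M[R]_n.+1).

(** This is T_N of the overview. *)
Definition pexp (N : nat) A : 'M[R]_n.+1 := (1 + N%:R^-1 *: A) ^+ N.

Lemma pexpE N A (t : R) :
  pexp N (t *: A) = horner_mx A ((1%:P + (t / N%:R) *: 'X) ^+ N).
Proof. by rewrite -affine_expE /pexp scalerA mulrC. Qed.

Lemma row_boundN A a : row_bound A a -> row_bound (- A) a.
Proof.
move=> Aa i; apply: le_trans (Aa i); apply: ler_sum => j _.
by rewrite mxE normrN.
Qed.

(** The trace inequality bounds the N-th power of D = (1 + A/N)(1 + B/N), whereas the left side is
    the N-th power of C = 1 + (A + B)/N. As D - C = AB/N^2, telescoping the N factors leaves an
    error of order 1/N. *)
Lemma pexp_golden_thompson k A B a b : A^T = A -> B^T = B ->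
  row_bound A a -> row_bound B b ->
  \tr (pexp (2 ^ k) (A + B)) <=
  \tr (pexp (2 ^ k) A * pexp (2 ^ k) B) +
  n.+1%:R * (a * b * expR (a + b + a * b)) / (2 ^ k)%:R.
Proof.
move=> symA symB Aa Bb; set N := (2 ^ k)%N.
have a0 := row_bound_ge0 Aa; have b0 := row_bound_ge0 Bb.
have N0 : (0 < N)%N by rewrite expn_gt0.
have NR0 : 0 < N%:R :> R by rewrite ltr0n.
have N1 : 1 <= N%:R :> R by rewrite ler1n.
pose u : R := N%:R^-1.
have u0 : 0 <= u by rewrite invr_ge0 ltW.
have u1 : u <= 1 by rewrite invf_le1.
pose C := 1 + u *: (A + B); pose D := (1 + u *: A) * (1 + u *: B).
(* A common row bound for C and D: the term ab u^2 coming from D is at most ab u because u <= 1. Its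
   N-th power stays below e^(a + b + ab) for every N. *)
pose c := 1 + (a + b + a * b) * u.
have c1 : 1 <= c by rewrite lerDl mulr_ge0 // !addr_ge0 // mulr_ge0.
have uA : row_bound (u *: A) (u * a) by exact: row_boundZ.
have uB : row_bound (u *: B) (u * b) by exact: row_boundZ.
have Cc : row_bound C c.
  rewrite /C scalerDr;
    apply: row_bound_le (row_boundD row_bound1 (row_boundD uA uB)).
  have := mulr_ge0 (mulr_ge0 a0 b0) u0; rewrite /c; lra.
have Dc : row_bound D c.
  apply: row_bound_le (row_boundM (row_boundD row_bound1 uA)
      (row_boundD row_bound1 uB)).
  have := ler_wpM2l (mulr_ge0 (mulr_ge0 a0 b0) u0) u1; rewrite /c; lra.
have CD : row_bound (C - D) (u * a * (u * b)).
  rewrite (_ : C - D = - ((u *: A) * (u *: B))); last first.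
    rewrite /C /D scalerDr mulrDl mul1r mulrDr mulr1.
    rewrite [u *: A + u *: B]addrC [1 + (_ + _)]addrA [1 + _ + (_ + _)]addrA.
    by rewrite opprD addrA subrr add0r.
  exact/row_boundN/row_boundM.
have tr_diff := mxtrace_row_bound (row_bound_exprB N c1 Cc Dc CD).
have symuA : (1 + u *: A)^T = 1 + u *: A
  by rewrite linearD linearZ /= trmx1 symA.
have symuB : (1 + u *: B)^T = 1 + u *: B
  by rewrite linearD linearZ /= trmx1 symB.
have [_ /(_ _ _ symuA symuB) GT] := mxtrace_pow2_le (R := R) (n := n) k.
rewrite /pexp -/N -/u -/C; apply: le_trans (lerD GT (lexx _)).
rewrite -/D -/N -lerBlDl -linearB; apply: (le_trans (ler_norm _)).
apply: (le_trans tr_diff); rewrite -[leRHS]mulrA ler_wpM2l ?ler0n //.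
have -> : N%:R * (u * a * (u * b)) = a * b * u.
  by rewrite /u; field; rewrite gt_eqF.
rewrite mulrAC ler_wpM2r // ler_wpM2l ?mulr_ge0 //.
by apply: expD1n_le_expR => //; rewrite !addr_ge0 // mulr_ge0.
Qed.

Lemma mxle_pexp N Y t : (0 < N)%N -> 0 <= t -> Y^T = Y ->
  (forall a, eigenvalue Y a -> `|a| <= 1) ->
  mxle (pexp N (t *: Y)) (1 + t *: Y + (expR t - 1 - t) *: Y ^+ 2).
Proof.
move=> N0 t0 symY Y1.
have -> : 1 + t *: Y + (expR t - 1 - t) *: Y ^+ 2 =
    horner_mx Y (1%:P + t *: 'X + (expR t - 1 - t) *: 'X^2).
  by rewrite !rmorphD /= !horner_mxZ rmorphXn /= horner_mx_C !horner_mx_X.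
rewrite pexpE; apply: mxle_horner => // y /Y1 y1.
have := expD1n_bennett N0 t0 y1.
by rewrite !(hornerE, horner_exp) /= -[t * y / _]mulrAC.
Qed.

(** For even N every eigenvalue contributes nonnegatively to the trace, so the largest one alone
    bounds it from below. *)
Lemma mxtrace_pexp_ge N Y t s : ~~ odd N -> 0 <= t -> Y^T = Y ->
  0 <= 1 + t * s / N%:R -> s <= lambda_max Y ->
  (1 + t * s / N%:R) ^+ N <= \tr (pexp N (t *: Y)).
Proof.
move=> evN t0 symY ts0 sY; rewrite pexpE.
apply: le_trans (mxtrace_horner_ge symY _); last first.
  by move=> a _; rewrite horner_exp exprn_even_ge0.
have le : 1 + t * s / N%:R <= 1 + t * lambda_max Y / N%:R.
  by rewrite lerD2l ler_wpM2r ?invr_ge0 // ler_wpM2l.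
rewrite !hornerE [X in _ <= (_ + X) ^+ _]mulrAC lerXn2r ?nnegrE //.
exact: le_trans le.
Qed.

End pexp.

(** * Random matrices with bounded entries *)

Section bounded_random_variables.
Context {R : realType} {disp : measure_display} {T : measurableType disp}.
Implicit Types f g : T -> R.

(** Bounded measurable functions form a ring on which the expectation is finite and linear, so
    integrability follows from closure under ring operations. *)
Definition bounded_rv f :=
  measurable_fun [set: T] f /\ exists C, forall w, `|f w| <= C.

Lemma bounded_rv_cst (c : R) : bounded_rv (fun=> c).
Proof. by split; [exact: measurable_cst|exists `|c|]. Qed.

Lemma bounded_rvD f g :
  bounded_rv f -> bounded_rv g -> bounded_rv (fun w => f w + g w).
Proof.
move=> [mf [C fC]] [mg [D gD]]; split; first exact: measurable_funD.
by exists (C + D) => w; rewrite (le_trans (ler_normD _ _)) // lerD.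
Qed.

Lemma bounded_rvM f g :
  bounded_rv f -> bounded_rv g -> bounded_rv (fun w => f w * g w).
Proof.
move=> [mf [C fC]] [mg [D gD]]; split; first exact: measurable_funM.
by exists (C * D) => w; rewrite normrM ler_pM.
Qed.

Lemma bounded_rvZ c f : bounded_rv f -> bounded_rv (fun w => c * f w).
Proof. exact/bounded_rvM/bounded_rv_cst. Qed.

Lemma bounded_rv_sum (I : Type) (r : seq I) (F : I -> T -> R) :
  (forall i, bounded_rv (F i)) -> bounded_rv (fun w => \sum_(i <- r) F i w).
Proof.
move=> bF; elim: r => [|i r IH].
  by under eq_fun do rewrite big_nil; exact: bounded_rv_cst.
by under eq_fun do rewrite big_cons; exact: bounded_rvD.
Qed.

Section expectation.
Variable P : probability T R.

Definition Ex f : R := fine ('E_P[f])%E.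

Lemma bounded_rv_integrable f : bounded_rv f -> P.-integrable setT (EFin \o f).
Proof.
move=> [mf [C fC]]; apply: measurable_bounded_integrable => //.
  exact: le_lt_trans (probability_le1 P measurableT) (ltry _).
exists C; split=> [|M CM w _]; first exact: num_real.
exact: le_trans (fC w) (ltW CM).
Qed.

Lemma expectation_Ex f : bounded_rv f -> 'E_P[f]%E = (Ex f)%:E.
Proof.
move=> bf; rewrite /Ex fineK // unlock.
exact: integrable_fin_num (bounded_rv_integrable bf).
Qed.

Lemma ExD f g : bounded_rv f -> bounded_rv g ->
  Ex (fun w => f w + g w) = Ex f + Ex g.
Proof.
move=> bf bg; rewrite /Ex unlock.
by apply: RintegralD => //; exact: bounded_rv_integrable.
Qed.

Lemma ExZ c f : bounded_rv f -> Ex (fun w => c * f w) = c * Ex f.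
Proof.
move=> bf; rewrite /Ex unlock.
by apply: RintegralZl => //; exact: bounded_rv_integrable.
Qed.

Lemma Ex_cst c : Ex (fun=> c) = c.
Proof. by rewrite /Ex expectation_cst. Qed.

Lemma Ex_sum (I : Type) (r : seq I) (F : I -> T -> R) :
  (forall i, bounded_rv (F i)) ->
  Ex (fun w => \sum_(i <- r) F i w) = \sum_(i <- r) Ex (F i).
Proof.
move=> bF; elim: r => [|i r IH].
  by under eq_fun do rewrite big_nil; rewrite Ex_cst big_nil.
under eq_fun do rewrite big_cons.
by rewrite big_cons -IH ExD //; exact: bounded_rv_sum.
Qed.

Lemma Ex_le f g : bounded_rv f -> bounded_rv g -> (forall w, f w <= g w) ->
  Ex f <= Ex g.
Proof.
move=> bf bg fg; rewrite /Ex unlock.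
by apply: le_Rintegral => //; exact: bounded_rv_integrable.
Qed.

Lemma Ex_markov f c : bounded_rv f -> (forall w, 0 <= f w) -> 0 < c ->
  (P [set w | (c <= f w)%R] <= (Ex f / c)%:E)%E.
Proof.
move=> bf f0 c0; have [mf _] := bf.
pose A := [set w | c <= f w].
have mA : measurable A.
  by rewrite -[A]setTI; exact: measurable_fun_le.
have bA : bounded_rv (\1_A : T -> R).
  split; first exact: measurable_indic.
  by exists 1 => w; rewrite indicE; case: (w \in A); rewrite ?normr1 ?normr0.
have ExA : (P A = (Ex \1_A)%:E)%E.
  by rewrite -expectation_Ex // unlock integral_indic // setIT.
rewrite -/A ExA lee_fin ler_pdivlMr // mulrC -ExZ //.
apply: Ex_le => // [|w]; first exact: bounded_rvZ.
by rewrite indicE; case: (boolP (w \in A)) => [/set_mem|];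
  rewrite ?mulr1 ?mulr0.
Qed.

End expectation.
End bounded_random_variables.

Section bounded_random_matrices.
Context {R : realType} {disp : measure_display} {T : measurableType disp}.
Context {n : nat}.
Implicit Types Y Z : T -> 'M[R]_n.+1.

Definition bounded_rmx Y := forall i j, bounded_rv (fun w => Y w i j).

Lemma bounded_rmx_cst (A : 'M[R]_n.+1) : bounded_rmx (fun=> A).
Proof. by move=> i j; exact: bounded_rv_cst. Qed.

Lemma bounded_rmxD Y Z :
  bounded_rmx Y -> bounded_rmx Z -> bounded_rmx (fun w => Y w + Z w).
Proof.
by move=> bY bZ i j; under eq_fun do rewrite mxE; exact: bounded_rvD.
Qed.

Lemma bounded_rmxM Y Z :
  bounded_rmx Y -> bounded_rmx Z -> bounded_rmx (fun w => Y w * Z w).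
Proof.
move=> bY bZ i j; under eq_fun do rewrite mxE.
by apply: bounded_rv_sum => k; exact: bounded_rvM.
Qed.

Lemma bounded_rmxZ c Y : bounded_rmx Y -> bounded_rmx (fun w => c *: Y w).
Proof. by move=> bY i j; under eq_fun do rewrite mxE; exact: bounded_rvZ. Qed.

Lemma bounded_rmxN Y : bounded_rmx Y -> bounded_rmx (fun w => - Y w).
Proof.
by move=> bY; under eq_fun do rewrite -scaleN1r; exact: bounded_rmxZ.
Qed.

Lemma bounded_rmxB Y Z :
  bounded_rmx Y -> bounded_rmx Z -> bounded_rmx (fun w => Y w - Z w).
Proof. by move=> bY bZ; apply: bounded_rmxD => //; exact: bounded_rmxN. Qed.

Lemma bounded_rmxX Y k : bounded_rmx Y -> bounded_rmx (fun w => Y w ^+ k).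
Proof.
move=> bY; elim: k => [|k IH].
  by under eq_fun do rewrite expr0; exact: bounded_rmx_cst.
by under eq_fun do rewrite exprS; exact: bounded_rmxM.
Qed.

Lemma bounded_rmx_sum (I : eqType) (r : seq I) (F : I -> T -> 'M[R]_n.+1) :
  (forall i, i \in r -> bounded_rmx (F i)) ->
  bounded_rmx (fun w => \sum_(i <- r) F i w).
Proof.
elim: r => [|i r IH] bF.
  by under eq_fun do rewrite big_nil; exact: bounded_rmx_cst.
under eq_fun do rewrite big_cons; apply: bounded_rmxD.
  by apply: bF; rewrite mem_head.
by apply: IH => j jr; apply: bF; rewrite inE jr orbT.
Qed.

Lemma bounded_rmx_pexp N Y : bounded_rmx Y ->
  bounded_rmx (fun w => pexp N (Y w)).
Proof.
by move=> bY; apply/bounded_rmxX/bounded_rmxD/bounded_rmxZ => //;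
  exact: bounded_rmx_cst.
Qed.

Lemma bounded_rv_mxtrace Y : bounded_rmx Y -> bounded_rv (fun w => \tr (Y w)).
Proof. by move=> bY; apply: bounded_rv_sum. Qed.

Lemma bounded_rv_qform Y v : bounded_rmx Y ->
  bounded_rv (fun w => qform (Y w) v).
Proof.
move=> bY; under eq_fun do rewrite qformE.
apply: bounded_rv_sum => i; apply: bounded_rv_sum => j.
by under eq_fun do rewrite mulrC; exact: bounded_rvZ.
Qed.

Lemma bounded_rmx_row_bound Y : bounded_rmx Y ->
  exists c, forall w, row_bound (Y w) c.
Proof.
move=> bY; have /choice[C YC] : forall ij : 'I_n.+1 * 'I_n.+1,
    exists c, forall w, `|Y w ij.1 ij.2| <= c.
  by move=> [i j]; have [_] := bY i j.
exists (\sum_i \sum_j C (i, j)) => w i.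
rewrite [leRHS](bigD1 i) //=; apply: ler_wpDr.
  apply: sumr_ge0 => k _; apply: sumr_ge0 => j _.
  exact: le_trans (YC (k, j) w).
by apply: ler_sum => j _; exact: (YC (i, j)).
Qed.

Section expectation.
Variable P : probability T R.

Lemma mx_expectationD Y Z : bounded_rmx Y -> bounded_rmx Z ->
  mx_expectation P (fun w => Y w + Z w) =
      mx_expectation P Y + mx_expectation P Z.
Proof.
move=> bY bZ; apply/matrixP => i j;
  rewrite !mxE -/(Ex P _) -!/(Ex P (fun w => _ w i j)).
by under eq_fun do rewrite mxE; rewrite ExD.
Qed.

Lemma mx_expectationZ c Y : bounded_rmx Y ->
  mx_expectation P (fun w => c *: Y w) = c *: mx_expectation P Y.
Proof.
move=> bY; apply/matrixP => i j; rewrite !mxE -/(Ex P _).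
by under eq_fun do rewrite mxE; rewrite ExZ.
Qed.

Lemma mx_expectationB Y Z : bounded_rmx Y -> bounded_rmx Z ->
  mx_expectation P (fun w => Y w - Z w) =
      mx_expectation P Y - mx_expectation P Z.
Proof.
move=> bY bZ; have -> : (fun w => Y w - Z w) = (fun w => Y w + (-1) *: Z w).
  by apply/funext => w; rewrite scaleN1r.
by rewrite mx_expectationD ?mx_expectationZ ?scaleN1r //; exact: bounded_rmxZ.
Qed.

Lemma mx_expectation_cst (A : 'M[R]_n.+1) : mx_expectation P (fun=> A) = A.
Proof. by apply/matrixP => i j; rewrite mxE -/(Ex P _) Ex_cst. Qed.

Lemma mx_expectationMl A Y : bounded_rmx Y ->
  mx_expectation P (fun w => A * Y w) = A * mx_expectation P Y.
Proof.
move=> bY; apply/matrixP => i j; rewrite mxE -/(Ex P _) -mulmxE mxE.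
under eq_fun do rewrite mxE.
rewrite Ex_sum => [|k]; last exact: bounded_rvZ.
by apply: eq_bigr => k _; rewrite ExZ // mxE.
Qed.

Lemma mx_expectationMr A Y : bounded_rmx Y ->
  mx_expectation P (fun w => Y w * A) = mx_expectation P Y * A.
Proof.
move=> bY; apply/matrixP => i j; rewrite mxE -/(Ex P _) -mulmxE mxE.
under eq_fun do (rewrite mxE; under eq_bigr do rewrite mulrC).
rewrite Ex_sum => [|k]; last exact: bounded_rvZ.
by apply: eq_bigr => k _; rewrite ExZ // mxE mulrC.
Qed.

Lemma Ex_mxtrace Y : bounded_rmx Y ->
  Ex P (fun w => \tr (Y w)) = \tr (mx_expectation P Y).
Proof. by move=> bY; rewrite Ex_sum //; apply: eq_bigr => i _; rewrite mxE. Qed.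

Lemma Ex_qform Y v : bounded_rmx Y ->
  Ex P (fun w => qform (Y w) v) = qform (mx_expectation P Y) v.
Proof.
move=> bY; rewrite qformE; under eq_fun do rewrite qformE.
have bYc c i j : bounded_rv (fun w => Y w i j * c).
  by under eq_fun do rewrite mulrC; exact: bounded_rvZ.
rewrite Ex_sum => [|i]; last exact: bounded_rv_sum.
apply: eq_bigr => i _; rewrite Ex_sum //; apply: eq_bigr => j _.
by rewrite [RHS]mulrC mxE -ExZ //; congr Ex; apply/funext => w; rewrite mulrC.
Qed.

Lemma mx_expectation_sym Y : (forall w, (Y w)^T = Y w) ->
  (mx_expectation P Y)^T = mx_expectation P Y.
Proof.
move=> symY; apply/matrixP => i j; rewrite !mxE.
by congr (fine (expectation P _)); apply/funext => w; rewrite -[in LHS]symY mxE.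
Qed.

Lemma mx_expectation_mxle Y Z : bounded_rmx Y -> bounded_rmx Z ->
  (forall w, mxle (Y w) (Z w)) ->
      mxle (mx_expectation P Y) (mx_expectation P Z).
Proof.
move=> bY bZ YZ v; rewrite -!Ex_qform //.
by apply: Ex_le => [| |w];
  [exact: bounded_rv_qform|exact: bounded_rv_qform|exact: YZ].
Qed.

End expectation.
End bounded_random_matrices.

(** * Independence *)

Section independence.
Context {R : realType} {disp : measure_display} {T : measurableType disp}.
Variable P : probability T R.
Implicit Types (A B : set T) (G H : set (set T)).

(** Uniqueness of finite measures: P(A and B) and P(A) P(B), as functions of A, agree on the
    pi-system G, which contains the whole space and thus provides the required cover. *)
Lemma generated_independent_left G B :
  G `<=` measurable -> setI_closed G -> G setT -> measurable B ->
  (forall A, G A -> P (A `&` B) = P A * P B)%E ->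
  forall A, <<s G >> A -> (P (A `&` B) = P A * P B)%E.
Proof.
move=> Gm GI GT mB PG.
have PBfin : (P B \is a fin_num)%E by exact: fin_num_measure.
have PB0 : 0 <= fine (P B) by exact: fine_ge0.
pose m1 := mrestr P mB.
pose m2 := mscale (NngNum PB0) P.
have m2E C : (m2 C = P C * P B)%E.
  transitivity ((fine (P B))%:E * P C)%E; first by [].
  by rewrite fineK // muleC.
move=> A sA; rewrite -m2E -[LHS]/(m1 A).
apply: (@g_sigma_algebra_measure_unique _ _ _ G Gm (fun=> setT) _ _ m1 m2) =>
  //.
- by apply/seteqP; split => // w _; exists 0%N.
- by move=> C GC; exact: etrans (PG C GC) (esym (m2E C)).
- move=> k; rewrite /m1 /mrestr.
  exact: le_lt_trans (probability_le1 P (measurableI _ _ measurableT mB))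
      (ltry _).
Qed.

Lemma generated_independent G H :
  G `<=` measurable -> setI_closed G -> G setT ->
  H `<=` measurable -> setI_closed H -> H setT ->
  (forall A B, G A -> H B -> P (A `&` B) = P A * P B)%E ->
  forall A B, <<s G >> A -> <<s H >> B -> (P (A `&` B) = P A * P B)%E.
Proof.
move=> Gm GI GT Hm HI HT PGH A B sA sB.
have mA : measurable A.
  by apply: (smallest_sub _ Gm) sA; exact: sigma_algebra_measurable.
rewrite setIC muleC; move: B sB.
apply: (generated_independent_left Hm HI HT mA) => B HB.
rewrite setIC muleC; apply: (generated_independent_left Gm GI GT (Hm _ HB)) sA.
by move=> C GC; exact: PGH.
Qed.

(* The absolute values in the proof make the integrand nonnegative on the whole
   plane, as Tonelli requires. *)
Lemma independent_integralM (U V : T -> R) :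
  measurable_fun [set: T] U -> measurable_fun [set: T] V ->
  (forall w, 0 <= U w) -> (forall w, 0 <= V w) ->
  (forall B C : set R, measurable B -> measurable C ->
     P (U @^-1` B `&` V @^-1` C) = P (U @^-1` B) * P (V @^-1` C))%E ->
  (\int[P]_w (U w * V w)%:E = (\int[P]_w (U w)%:E) * \int[P]_w (V w)%:E)%E.
Proof.
move=> mU mV U0 V0 indep.
have UM : U \in mfun by rewrite inE.
have VM : V \in mfun by rewrite inE.
pose U' : {mfun T >-> R} := mfun_Sub UM.
pose V' : {mfun T >-> R} := mfun_Sub VM.
have mUV : measurable_fun [set: T] (fun w => (U w, V w))
  by exact: measurable_fun_pair.
have UVM : (fun w => (U w, V w)) \in @mfun _ _ T (R * R)%type by rewrite inE.
pose UV : {mfun T >-> (R * R)%type} := mfun_Sub UVM.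
pose m1 : probability _ _ := distribution P U'.
pose m2 : probability _ _ := distribution P V'.
pose m' : probability _ _ := distribution P UV.
have mnorm : measurable_fun [set: R] (fun x : R => `|x|%:E).
  by apply/measurable_EFinP; exact: normr_measurable.
(* By independence the joint law and the product law agree on rectangles, hence everywhere; Tonelli
   then splits the integral. *)
have m'E X : measurable X -> (m1 \x m2)%E X = m' X.
  apply: product_measure_unique => B C mB mC.
  rewrite /m1 /m2 /m' /distribution /pushforward /= -indep //.
pose g (z : R * R) : \bar R := (`|z.1| * `|z.2|)%:E.
have mg : measurable_fun [set: R * R] g.
  apply/measurable_EFinP; apply: measurable_funM.
    by apply: measurableT_comp; [exact: normr_measurable|exact: measurable_fst].
  by apply: measurableT_comp; [exact: normr_measurable|exact: measurable_snd].
have g0 z : (0 <= g z)%E by rewrite lee_fin mulr_ge0.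
transitivity (\int[m']_z g z)%E.
  rewrite ge0_integral_pushforward //=.
  by apply: eq_integral => w _; rewrite /g /= !ger0_norm.
transitivity (\int[m1 \x m2]_z g z)%E.
  by apply: eq_measure_integral => X mX _; exact: esym (m'E X mX).
rewrite fubini_tonelli1 //.
transitivity (\int[m1]_x (`|x|%:E * \int[m2]_y `|y|%:E))%E.
  apply: eq_integral => x _; rewrite /fubini_F.
  rewrite -ge0_integralZl //.
rewrite ge0_integralZr //; last exact: integral_ge0.
rewrite !ge0_integral_pushforward //=.
congr (_ * _)%E; apply: eq_integral => w _; rewrite /= ger0_norm //.
Qed.

(** Adding to U and V constants that bound them reduces to nonnegative functions; expanding both
    sides by linearity, the extra terms cancel. *)
Lemma independent_ExM (U V : T -> R) : bounded_rv U -> bounded_rv V ->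
  (forall B C : set R, measurable B -> measurable C ->
     P (U @^-1` B `&` V @^-1` C) = P (U @^-1` B) * P (V @^-1` C))%E ->
  Ex P (fun w => U w * V w) = Ex P U * Ex P V.
Proof.
move=> bU bV indep; have [mU [a Ua]] := bU; have [mV [b Vb]] := bV.
have bUa : bounded_rv (fun w => U w + a) by apply/bounded_rvD/bounded_rv_cst.
have bVb : bounded_rv (fun w => V w + b) by apply/bounded_rvD/bounded_rv_cst.
have shift (f : T -> R) c (B : set R) :
    (fun w => f w + c) @^-1` B = f @^-1` ((fun x => x + c) @^-1` B) by [].
have mshift c (B : set R) : measurable B ->
  measurable ((fun x : R => x + c) @^-1` B).
  move=> mB; rewrite -[X in measurable X]setTI.
  by apply: measurable_funD => //; exact: measurable_cst.
have ge0 (f : T -> R) c : (forall w, `|f w| <= c) -> forall w, 0 <= f w + c.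
  by move=> fc w; move: (fc w); rewrite ler_norml; lra.
have indep_shift (B C : set R) : measurable B -> measurable C ->
    (P ((fun w => U w + a)%R @^-1` B `&` (fun w => V w + b)%R @^-1` C) =
     P ((fun w => U w + a)%R @^-1` B) * P ((fun w => V w + b)%R @^-1` C))%E.
  by move=> mB mC; rewrite !shift; apply: indep; exact: mshift.
have := independent_integralM bUa.1 bVb.1 (ge0 _ _ Ua) (ge0 _ _ Vb) indep_shift.
have -> : ((\int[P]_w ((U w + a) * (V w + b))%:E) =
    (Ex P (fun w => (U w + a) * (V w + b))%R)%:E)%E.
  by rewrite -expectation_Ex ?unlock //; exact: bounded_rvM.
have -> : ((\int[P]_w (U w + a)%:E) = (Ex P (fun w => U w + a)%R)%:E)%E.
  by rewrite -expectation_Ex ?unlock.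
have -> : ((\int[P]_w (V w + b)%:E) = (Ex P (fun w => V w + b)%R)%:E)%E.
  by rewrite -expectation_Ex ?unlock.
rewrite -EFinM => /(congr1 fine) /=.
have -> : (fun w => (U w + a) * (V w + b)) =
    (fun w => U w * V w + (b * U w + (a * V w + a * b))).
  by apply/funext => w; ring.
have bUV := bounded_rvM bU bV.
have bbU := bounded_rvZ b bU; have baV := bounded_rvZ a bV.
have bc c : bounded_rv (fun=> c : R) by exact: bounded_rv_cst.
rewrite !(ExD, ExZ, Ex_cst) //; first by lra.
all: by repeat apply: bounded_rvD.
Qed.

End independence.

Section independent_matrices.
Context {R : realType} {disp : measure_display} {T : measurableType disp}.
Variables (P : probability T R) (n : nat) (X : nat -> T -> 'M[R]_n.+1).

(** The finite-dimensional events of the X i with i in I: a pi-system generating their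
    sigma-algebra, and the kind of events that [mx_independent] factors. B is defined at every index
    so that two families can be merged with [setT] as default. *)
Definition cylinders (I : set nat) : set (set T) :=
  [set A | exists s : seq nat, exists B : nat -> set 'M[R]_n.+1,
    [/\ uniq s, forall i, i \in s -> I i, forall i, mx_measurable (B i)
      & A = \bigcap_(i in [set` s]) (X i @^-1` B i)]].

Lemma mx_measurable_setT : @mx_measurable R n.+1 setT.
Proof. exact: (@measurableT _ (g_sigma_algebraType _)). Qed.

Lemma mx_measurable_setI (A B : set 'M[R]_n.+1) :
  mx_measurable A -> mx_measurable B -> mx_measurable (A `&` B).
Proof. exact: (@measurableI _ (g_sigma_algebraType _)). Qed.

Lemma cylinders_setT I : cylinders I setT.
Proof.
exists [::], (fun=> setT); split=> //; first by move=> _;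
  exact: mx_measurable_setT.
by rewrite set_nil bigcap_set0.
Qed.

Lemma cylinders_setI I : setI_closed (cylinders I).
Proof.
move=> _ _ [s [B [us sI mB ->]]] [t [C [ut tI mC ->]]].
exists (undup (s ++ t)).
exists (fun i => (if i \in s then B i else setT) `&`
  (if i \in t then C i else setT)).
split; first exact: undup_uniq.
- by move=> i; rewrite mem_undup mem_cat => /orP[/sI|/tI].
- move=> i; apply: mx_measurable_setI; case: ifP => _ //;
  exact: mx_measurable_setT.
apply/seteqP; split=> w.
  move=> [sw tw] i /= _; split.
    by case: ifP => // si; exact: sw.
  by case: ifP => // ti; exact: tw.
move=> h; split=> i /= si; have := h i;
  rewrite /= mem_undup mem_cat si ?orbT => /(_ isT).
  by case.
by case.
Qed.

Lemma cylinders_measurable I : (forall i, I i -> random_mx (X i)) ->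
  cylinders I `<=` measurable.
Proof.
move=> rX _ [s [B [us sI mB ->]]]; apply: bigcap_measurableType => //.
by move=> i /= /sI/rX; apply.
Qed.

Lemma mx_entry_measurable i j (B : set R) : measurable B ->
  mx_measurable [set A : 'M[R]_n.+1 | B (A i j)].
Proof.
move=> mB; apply: sub_sigma_algebra; exists (i, j) => //.
by exists B => //; rewrite setTI.
Qed.

(** The sample space with the sigma-algebra generated by the X i, i in I. Thus
    [bounded_rmx (T := cylinder_type I) Y] says that Y is bounded and measurable with respect to
    those X i, and the closure lemmas for [bounded_rmx] apply unchanged. *)
Definition cylinder_type I := g_sigma_algebraType (cylinders I).

Lemma cylinder_bounded_rmx (I : set nat) i c : I i ->
  (forall w k l, `|X i w k l| <= c) ->
  bounded_rmx (T := cylinder_type I) (X i).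
Proof.
move=> Ii Xc k l; split; last by exists c => w; exact: Xc.
move=> _ B mB; rewrite setTI; apply: sub_sigma_algebra.
exists [:: i], (fun=> [set A | B (A k l)]); split => //.
- by move=> j; rewrite inE => /eqP ->.
- by move=> j; exact: mx_entry_measurable.
- by rewrite set_cons1 bigcap_set1.
Qed.

Lemma cylinder_bounded_rmx_sub (I : set nat) (Y : T -> 'M[R]_n.+1) :
  (forall i, I i -> random_mx (X i)) ->
  bounded_rmx (T := cylinder_type I) Y -> bounded_rmx Y.
Proof.
move=> rX bY i j; have [mY bd] := bY i j; split=> // _ B mB.
have sY := mY measurableT B mB.
apply: (smallest_sub _ (cylinders_measurable rX)) sY.
exact: sigma_algebra_measurable.
Qed.

(** A cylinder over I and one over the disjoint J merge into a single cylinder over K, which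
    [mx_independent] factors. The pi-system argument extends this to the generated sigma-algebras,
    and a matrix product is a sum of products of entries. *)
Lemma independent_mx_expectationM (K I J : set nat) (U V : T -> 'M[R]_n.+1) :
  mx_independent P K X -> (forall i, K i -> random_mx (X i)) ->
  I `<=` K -> J `<=` K -> [disjoint I & J] ->
  bounded_rmx (T := cylinder_type I) U ->
      bounded_rmx (T := cylinder_type J) V ->
  mx_expectation P (fun w => U w * V w) =
      mx_expectation P U * mx_expectation P V.
Proof.
move=> indepX rX IK JK /disj_setPLR IJ bU bV.
have rXI i : I i -> random_mx (X i) by move=> /IK; exact: rX.
have rXJ i : J i -> random_mx (X i) by move=> /JK; exact: rX.
have indep_cyl A B : cylinders I A -> cylinders J B ->
  (P (A `&` B) = P A * P B)%E.
  move=> [s [C [us sI mC ->]]] [t [D [ut tJ mD ->]]].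
  have st i : i \in t -> i \notin s.
    by move=> it; apply/negP => /sI/IJ; apply; exact: tJ.
  pose E i := if i \in s then C i else D i.
  have -> : \bigcap_(i in [set` s]) (X i @^-1` C i) `&`
      \bigcap_(i in [set` t]) (X i @^-1` D i) =
      \bigcap_(i in [set` s ++ t]) (X i @^-1` E i).
    apply/seteqP; split=> w.
      move=> [sw tw] i /=; rewrite mem_cat /E => /orP[si|ti].
        by rewrite si; exact: sw.
      by rewrite (negbTE (st _ ti)); exact: tw.
    move=> h; split=> i /= si; have := h i; rewrite /= mem_cat si ?orbT /E.
      by rewrite si => /(_ isT).
    by rewrite (negbTE (st _ si)) => /(_ isT).
  rewrite indepX.
  - rewrite big_cat /=; congr (_ * _)%E.
      rewrite indepX //; first by apply: eq_big_seq => i; rewrite /E => ->.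
      by move=> i /sI/IK.
    rewrite indepX //; last by move=> i /tJ/JK.
    by apply: eq_big_seq => i /st/negbTE; rewrite /E => ->.
  - rewrite cat_uniq us ut andbT /=; apply/hasPn => i; exact: st.
  - by move=> i; rewrite mem_cat => /orP[/sI/IK|/tJ/JK].
  - by move=> i _; rewrite /E; case: ifP.
have indep_gen := generated_independent (cylinders_measurable rXI)
  (@cylinders_setI I) (cylinders_setT I) (cylinders_measurable rXJ)
  (@cylinders_setI J) (cylinders_setT J) indep_cyl.
have bU' := cylinder_bounded_rmx_sub rXI bU.
have bV' := cylinder_bounded_rmx_sub rXJ bV.
apply/matrixP => i j; rewrite mxE -/(Ex P _) -mulmxE mxE.
under eq_fun do rewrite mxE.
rewrite Ex_sum => [|k]; last exact: bounded_rvM.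
apply: eq_bigr => k _; rewrite !mxE; apply: independent_ExM => // B C mB mC.
have [mU _] := bU i k; have [mV _] := bV k j.
apply: indep_gen; first by have := mU measurableT B mB; rewrite setTI.
by have := mV measurableT C mC; rewrite setTI.
Qed.

End independent_matrices.

(** * Matrix Bernstein inequality *)

Section measurable_eigenvalues.
Context {R : realType} {disp : measure_display} {T : measurableType disp}.
Context {n : nat}.
Implicit Types (Y : T -> 'M[R]_n.+1).

(** Schur's test: |A i j v_i v_j| <= |A i j| (v_i^2 + v_j^2) / 2, and by symmetry the two halves
    contribute equally, each as row sums against the v_i^2. *)
Lemma row_bound_mxle (A : 'M[R]_n.+1) c : A^T = A -> row_bound A c ->
  mxle (- c)%:M A /\ mxle A c%:M.
Proof.
move=> symA Ac.
suff norm_le v : `|qform A v| <= c * qform 1%:M v.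
  split=> v; have := norm_le v; rewrite ler_norml => /andP[].
    by rewrite -[(- c)%:M]scalemx1 qformZ mulNr.
  by rewrite -[c%:M]scalemx1 qformZ.
rewrite qformE qform1E mulr_sumr.
apply: (@le_trans _ _ (\sum_i \sum_j `|A i j| * v 0 i ^+ 2)); last first.
  by apply: ler_sum => i _; rewrite -mulr_suml ler_wpM2r ?sqr_ge0.
have swap : \sum_i \sum_j `|A i j| * v 0 j ^+ 2 =
    \sum_i \sum_j `|A i j| * v 0 i ^+ 2.
  rewrite exchange_big; apply: eq_bigr => i _; apply: eq_bigr => j _ /=.
  by rewrite -[in LHS]symA mxE.
have -> : \sum_i \sum_j `|A i j| * v 0 i ^+ 2 =
    \sum_i \sum_j `|A i j| * ((v 0 i ^+ 2 + v 0 j ^+ 2) / 2).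
  transitivity ((\sum_i \sum_j `|A i j| * v 0 i ^+ 2 +
    \sum_i \sum_j `|A i j| * v 0 j ^+ 2) / 2); first by rewrite swap; lra.
  rewrite -big_split mulr_suml; apply: eq_bigr => i _.
  rewrite -big_split mulr_suml; apply: eq_bigr => j _ /=.
  by rewrite -mulrDr mulrA.
apply: (le_trans (ler_norm_sum _ _ _)); apply: ler_sum => i _.
apply: (le_trans (ler_norm_sum _ _ _)); apply: ler_sum => j _.
rewrite normrM ler_wpM2l // ler_norml.
have := sqr_ge0 (v 0 i - v 0 j); have := sqr_ge0 (v 0 i + v 0 j).
by rewrite sqrrB sqrrD => ? ?; apply/andP; split; lra.
Qed.

Lemma measurable_spectral_norm Y : bounded_rmx Y -> (forall w, (Y w)^T = Y w) ->
  measurable_fun [set: T] (fun w => spectral_norm (Y w)).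
Proof.
move=> bY symY mT; apply: (measurability _ (RGenOInfty.measurableE R)) => //.
move=> _ [_ [b ->] <-]; rewrite setTI.
have [b0|b0] := leP 0 b; last first.
  suff -> : (fun w => spectral_norm (Y w)) @^-1` `]b, +oo[ = setT by [].
  apply/seteqP; split=> // w _ /=.
  by rewrite in_itv /= andbT (lt_le_trans b0) // spectral_norm_ge0.
suff -> : (fun w => spectral_norm (Y w)) @^-1` `]b, +oo[ =
    \bigcup_k ((fun w => \tr (Y w ^+ (k.+1).*2)) @^-1`
      `]n.+1%:R * b ^+ (k.+1).*2, +oo[).
  apply: bigcup_measurable => k _; rewrite -[X in measurable X]setTI.
  have [mtr _] := bounded_rv_mxtrace (bounded_rmxX (k.+1).*2 bY).
  by apply: mtr => //; exact: measurable_itv.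
apply/seteqP; split=> w /=; rewrite ?in_itv /= ?andbT.
  move=> /(spectral_norm_gtP (symY w) b0)[k bk].
  by exists k => //=; rewrite in_itv /= andbT.
move=> [k _ /=]; rewrite in_itv /= andbT => bk.
by apply/(spectral_norm_gtP (symY w) b0); exists k.
Qed.

(** Adding a row bound c valid for all w makes Y positive semidefinite, where norm and largest
    eigenvalue coincide. *)
Lemma measurable_lambda_max Y : bounded_rmx Y -> (forall w, (Y w)^T = Y w) ->
  measurable_fun [set: T] (fun w => lambda_max (Y w)).
Proof.
move=> bY symY; have [c Yc] := bounded_rmx_row_bound bY.
have symYc w : (Y w + c%:M)^T = Y w + c%:M.
  by rewrite linearD /= symY tr_scalar_mx.
have -> : (fun w => lambda_max (Y w)) =
    (fun w => spectral_norm (Y w + c%:M) - c).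
  apply/funext => w; rewrite spectral_norm_psd // ?lambda_max_shift ?addrK //.
  move=> v; have [/(_ v) + _] := row_bound_mxle (symY w) (Yc w).
  by rewrite qformD qform0 -[(- c)%:M]scalemx1 -[c%:M]scalemx1 !qformZ; lra.
apply: measurable_funB; last exact: measurable_cst.
apply: measurable_spectral_norm => //.
by apply: bounded_rmxD => //; exact: bounded_rmx_cst.
Qed.

End measurable_eigenvalues.

(** It suffices that e^(y - y^2) <= 1 + y for y = x/N, which follows from e^(-z) >= 1 - z at z = y -
    y^2 and (1 - y + y^2)(1 + y) = 1 + y^3. It bounds the denominator in Markov's inequality. *)
Lemma expD1n_ge_expR (R : realType) (x : R) N : 0 <= x -> (0 < N)%N ->
  expR (x - x ^+ 2 / N%:R) <= (1 + x / N%:R) ^+ N.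
Proof.
move=> x0 N0; have NR0 : N%:R != 0 :> R by rewrite pnatr_eq0 -lt0n.
have -> : x - x ^+ 2 / N%:R = N%:R * (x / N%:R - (x / N%:R) ^+ 2) by field.
set y := x / N%:R; have y0 : 0 <= y by rewrite divr_ge0.
rewrite expRM_natl lerXn2r ?nnegrE ?expR_ge0 ?addr_ge0 //.
have := expR_ge1Dx (- (y - y ^+ 2)); rewrite expRN => inv_ge.
have key : (1 - (y - y ^+ 2)) * expR (y - y ^+ 2) <= 1.
  by rewrite -ler_pdivlMr ?expR_gt0 // mul1r.
have pos : 0 < 1 - (y - y ^+ 2) by have := sqr_ge0 (y - 2^-1); rewrite sqrrB;
  lra.
rewrite -(ler_pM2l pos); apply: (le_trans key).
have -> : (1 - (y - y ^+ 2)) * (1 + y) = 1 + y ^+ 3 by ring.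
by rewrite lerDl exprn_ge0.
Qed.

Lemma mxtrace_pexp_ge0 (R : realType) n p (A : 'M[R]_n.+1) : A^T = A ->
  0 <= \tr (pexp (2 ^ p.+1) A).
Proof.
move=> symA; rewrite /pexp expnSr exprM.
set B := (_ + _) ^+ _; have symB : B^T = B.
  by rewrite trmx_expr linearD linearZ /= symA trmx1.
rewrite expr2 -[X in X * _]symB; apply: sumr_ge0 => i _.
rewrite -mulmxE mxE sumr_ge0 // => j _.
by rewrite mxE -expr2 sqr_ge0.
Qed.

(** * Trace moments of a sum and Chernoff's bound *)

Section matrix_chernoff.
Context {R : realType} {disp : measure_display} {T : measurableType disp}.
Variables (P : probability T R) (n m : nat) (Y : nat -> T -> 'M[R]_n.+1)
  (v : R).

Definition partial_sum k w := \sum_(i < k) Y i w.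

Hypothesis symY : forall k, (k < m)%N -> forall w, (Y k w)^T = Y k w.
Hypothesis boundY : forall k, (k < m)%N ->
  forall w a, eigenvalue (Y k w) a -> `|a| <= 1.
Hypothesis bddY : forall k, (k < m)%N -> bounded_rmx (Y k).
Hypothesis meanY : forall k, (k < m)%N -> mx_expectation P (Y k) = 0.
Hypothesis varY : forall k, (k < m)%N ->
  mxle (mx_expectation P (fun w => Y k w ^+ 2)) v%:M.
Hypothesis indepY : forall k N t, (k < m)%N ->
  mx_expectation P
    (fun w => pexp N (t *: partial_sum k w) * pexp N (t *: Y k w)) =
  mx_expectation P (fun w => pexp N (t *: partial_sum k w)) *
  mx_expectation P (fun w => pexp N (t *: Y k w)).
Hypothesis v0 : 0 <= v.

Lemma partial_sum_sym k w : (k <= m)%N -> (partial_sum k w)^T = partial_sum k w.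
Proof.
move=> km; rewrite /partial_sum linear_sum; apply: eq_bigr => i _.
exact: symY (leq_trans (ltn_ord i) km) w.
Qed.

Lemma partial_sum_bounded k : (k <= m)%N -> bounded_rmx (partial_sum k).
Proof.
move=> km; rewrite /partial_sum.
under eq_fun do rewrite -(big_mkord xpredT (fun i => Y i _)).
apply: bounded_rmx_sum => i; rewrite mem_index_iota => /andP[_ ik].
by apply: bddY; rewrite (leq_trans ik).
Qed.

Let phi t := expR t - 1 - t : R.

Let phi_ge0 t : 0 <= phi t.
Proof. by rewrite /phi -addrA -opprD subr_ge0 expR_ge1Dx. Qed.

Lemma mx_expectation_pexp_le k t N : (k < m)%N -> (0 < N)%N -> 0 <= t ->
  mxle (mx_expectation P (fun w => pexp N (t *: Y k w))) (1 + phi t * v)%:M.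
Proof.
move=> km N0 t0 u; have bY := bddY km.
have bZ : bounded_rmx (fun w => 1 + t *: Y k w + phi t *: Y k w ^+ 2).
  apply: bounded_rmxD; last exact/bounded_rmxZ/bounded_rmxX.
  by apply: bounded_rmxD; [exact: bounded_rmx_cst|exact: bounded_rmxZ].
have := mx_expectation_mxle P (bounded_rmx_pexp N (bounded_rmxZ t bY)) bZ
  (fun w => mxle_pexp N0 t0 (symY km w) (boundY km (w := w))).
move=> /(_ u)/le_trans; apply.
rewrite mx_expectationD; [|by apply: bounded_rmxD;
  [exact: bounded_rmx_cst|exact: bounded_rmxZ]|exact/bounded_rmxZ/bounded_rmxX].
rewrite mx_expectationD; [|exact: bounded_rmx_cst|exact: bounded_rmxZ].
rewrite mx_expectation_cst !mx_expectationZ //; last exact: bounded_rmxX.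
rewrite meanY // scaler0 addr0 raddfD /= !qformD lerD2l qformZ.
rewrite -[(phi t * v)%:M]scalemx1 -scalerA qformZ ler_wpM2l //.
by rewrite scalemx1; exact: varY.
Qed.

(** K depends on t and k but not on p, so the error vanishes as p -> oo. The exponent p.+1 keeps N
    even, which makes T_N of the partial sum a square. *)
Lemma Ex_mxtrace_pexp_le t k : 0 <= t -> (k <= m)%N -> exists K, forall p,
  Ex P (fun w => \tr (pexp (2 ^ p.+1) (t *: partial_sum k w))) <=
  (1 + phi t * v) ^+ k * n.+1%:R + K / (2 ^ p.+1)%:R.
Proof.
move=> t0; have rho0 : 0 <= 1 + phi t * v by rewrite addr_ge0 // mulr_ge0.
have := @mx_expectation_pexp_le ^~ t;
  move: (1 + phi t * v) rho0 => rho rho0 EY_le.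
elim: k => [_|k IH km].
  exists 0 => p; rewrite mul0r addr0 expr0 mul1r.
  have -> : (fun w => \tr (pexp (2 ^ p.+1) (t *: partial_sum 0 w))) =
      fun=> n.+1%:R.
    apply/funext => w;
      rewrite /partial_sum big_ord0 scaler0 /pexp scaler0 addr0.
    by rewrite expr1n mxtrace1.
  by rewrite Ex_cst.
have [K QK] := IH (ltnW km).
have bS := bounded_rmxZ t (partial_sum_bounded (ltnW km)).
have bY := bounded_rmxZ t (bddY km).
have [a Sa] := bounded_rmx_row_bound bS.
have [b Yb] := bounded_rmx_row_bound bY.
(* The earlier error is multiplied by rho together with the rest; the new term is the
   Golden-Thompson error, with row bounds a and b uniform in w. *)
exists (rho * K + n.+1%:R * (a * b * expR (a + b + a * b))) => p.
set N := (2 ^ p.+1)%N; set C := n.+1%:R * _.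
have symS w : (t *: partial_sum k w)^T = t *: partial_sum k w.
  by rewrite linearZ /= partial_sum_sym // ltnW.
have symtY w : (t *: Y k w)^T = t *: Y k w by rewrite linearZ /= symY.
have bpS := bounded_rmx_pexp N bS; have bpY := bounded_rmx_pexp N bY.
set EY := mx_expectation P (fun w => pexp N (t *: Y k w)).
have bSE : bounded_rmx (fun w => pexp N (t *: partial_sum k w) * EY).
  by apply: bounded_rmxM => //; exact: bounded_rmx_cst.
apply: (@le_trans _ _ (Ex P (fun w =>
    \tr (pexp N (t *: partial_sum k w) * pexp N (t *: Y k w)) + C / N%:R))).
  apply: Ex_le => [||w].
  - apply/bounded_rv_mxtrace/bounded_rmx_pexp/bounded_rmxZ.
    exact: partial_sum_bounded.
  - by apply/bounded_rvD/bounded_rv_cst/bounded_rv_mxtrace/bounded_rmxM.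
  - rewrite /partial_sum big_ord_recr /= -/(partial_sum k w) scalerDr.
    exact: pexp_golden_thompson.
rewrite ExD; [|exact/bounded_rv_mxtrace/bounded_rmxM|exact: bounded_rv_cst].
rewrite Ex_cst Ex_mxtrace; last exact: bounded_rmxM.
(* Independence replaces the factor of Y k by its mean EY. Moved back under the expectation, it
   leaves for each w the trace of a square times EY, where EY is at most rho. *)
rewrite indepY // -/EY -mx_expectationMr // -Ex_mxtrace //.
rewrite [in leRHS]mulrDl [in leRHS]addrA lerD2r exprS -!mulrA -mulrDr.
apply: le_trans (ler_wpM2l rho0 (QK p)).
rewrite -ExZ; last exact: bounded_rv_mxtrace.
apply: Ex_le => [||w]; first exact: bounded_rv_mxtrace.
  exact/bounded_rvZ/bounded_rv_mxtrace.
have -> : pexp N (t *: partial_sum k w) =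
    ((1 + N%:R^-1 *: (t *: partial_sum k w)) ^+ (2 ^ p)) ^+ 2.
  by rewrite -exprM -expnSr.
apply: mxtrace_sqr_mul_le; last by apply: EY_le; rewrite ?expn_gt0.
by rewrite trmx_expr linearD [in LHS]linearZ /= symS trmx1.
Qed.

Lemma matrix_chernoff t s : 0 <= t -> 0 <= s ->
  (P [set w | (s <= lambda_max (partial_sum m w))%R] <=
   (n.+1%:R * expR (- (t * s)) * (1 + phi t * v) ^+ m)%:E)%E.
Proof.
move=> t0 s0; set A := [set w | _]; set c := (1 + phi t * v) ^+ m.
have bS := partial_sum_bounded (leqnn m).
have symS w := partial_sum_sym w (leqnn m).
have mA : measurable A.
  rewrite -[A]setTI; apply: measurable_fun_le => //.
  exact: measurable_lambda_max.
have [K QK] := Ex_mxtrace_pexp_le t0 (leqnn m).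
have fA : (P A = (fine (P A))%:E)%E by rewrite fineK //; exact: fin_num_measure.
rewrite fA lee_fin.
(* h p is 1/N for N = 2^(p+1), in geometric form so that its limit is immediate. *)
pose h p : R := 2^-1 * 2^-1 ^+ p.
have h_inv p : h p = ((2 ^ p.+1)%:R)^-1 by rewrite /h -exprS exprVn natrX.
have h_ge0 p : 0 <= h p by rewrite h_inv invr_ge0.
set x := t * s; have x0 : 0 <= x by rewrite mulr_ge0.
(* Markov's inequality for the trace; the denominator (1 + x/N)^N is at least e^(x - x^2/N). *)
have bound p : fine (P A) <=
    (c * n.+1%:R + K * h p) * (expR (- x) * expR (x ^+ 2 * h p)).
  rewrite h_inv; set N := (2 ^ p.+1)%N.
  have N0 : (0 < N)%N by rewrite expn_gt0.
  have evN : ~~ odd N by rewrite oddX.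
  have u_gt0 : 0 < 1 + x / N%:R by rewrite ltr_pwDl // divr_ge0.
  have btr := bounded_rv_mxtrace (bounded_rmx_pexp N (bounded_rmxZ t bS)).
  have tr_ge0 w : 0 <= \tr (pexp N (t *: partial_sum m w)).
    by apply: mxtrace_pexp_ge0; rewrite linearZ /= symS.
  have markov := Ex_markov P btr tr_ge0 (exprn_gt0 N u_gt0).
  have sub : A `<=` [set w | (1 + x / N%:R) ^+ N <=
      \tr (pexp N (t *: partial_sum m w))].
    by move=> w /= sw; apply: mxtrace_pexp_ge => //; exact: ltW.
  have mE : measurable [set w | (1 + x / N%:R) ^+ N <=
      \tr (pexp N (t *: partial_sum m w))].
    rewrite -[X in measurable X]setTI; apply: measurable_fun_le => //.
    by have [] := btr.
  have PA_le : fine (P A) <= Ex P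
      (fun w => \tr (pexp N (t *: partial_sum m w))) /
      (1 + x / N%:R) ^+ N.
    rewrite -lee_fin -fA.
    exact: le_trans (le_measure P (mem_set mA) (mem_set mE) sub) markov.
  apply: (le_trans PA_le).
  have Q0 : 0 <= Ex P (fun w => \tr (pexp N (t *: partial_sum m w))).
    by rewrite -(Ex_cst P 0); apply: Ex_le => //; exact: bounded_rv_cst.
  apply: ler_pM => //; first by rewrite invr_ge0 exprn_ge0 // ltW.
    exact: QK.
  rewrite -expRD -[leRHS]invrK -expRN opprD opprK.
  by rewrite lef_pV2 ?posrE ?exprn_gt0 ?expR_gt0 // expD1n_ge_expR.
have h_cvg : h @ \oo --> (0 : R).
  rewrite -[X in _ --> X](mulr0 2^-1); apply: cvgMr.
  by apply: cvg_expr; rewrite ger0_norm ?invr_ge0 // invf_lt1 // ltr1n.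
(* P A does not involve p, so [bound] survives the limit. *)
have : (fun p => (c * n.+1%:R + K * h p) * (expR (- x) * expR (x ^+ 2 * h p)))
    @ \oo --> (c * n.+1%:R + K * 0) * (expR (- x) * expR (x ^+ 2 * 0)).
  apply: cvgM; first by apply: cvgD; [exact: cvg_cst|exact: cvgMr].
  apply: cvgMr; apply: continuous_cvg; first exact: continuous_expR.
  exact: cvgMr.
rewrite !mulr0 addr0 expR0 mulr1 -[_ * c]mulrC mulrA => /cvgr_to_ge; apply.
by apply: nearW.
Qed.

End matrix_chernoff.

(* [t = s / (1 + s / 3)] with [s = sqrt (2 L / w)] is the optimal sub-gamma
   choice; for [w = 0] it would be infinite and [t = 3] suffices. *)
Lemma bernstein_exponent (R : realType) (w L : R) : 0 <= w -> 0 <= L ->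
  exists2 t : R, 0 <= t &
    (expR t - 1 - t) * w - t * (Num.sqrt (2 * w * L) + L / 3) <= - L.
Proof.
move=> w0 L0; have [->|wn0] := eqVneq w 0.
  by exists 3 => //; rewrite !mulr0 mul0r sqrtr0; lra.
have {wn0} w_gt0 : 0 < w by rewrite lt_neqAle eq_sym wn0.
pose s := Num.sqrt (2 * L / w); have s0 : 0 <= s by rewrite sqrtr_ge0.
have s2 : w * s ^+ 2 = 2 * L.
  by rewrite sqr_sqrtr ?divr_ge0 ?mulr_ge0 // mulrC divfK // gt_eqF.
have sw : Num.sqrt (2 * w * L) = w * s.
  have -> : 2 * w * L = (w * s) ^+ 2 
    by transitivity (w * (w * s ^+ 2)); [rewrite s2; ring|ring].
  by rewrite sqrtr_sqr ger0_norm // mulr_ge0.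
pose q := 1 + s / 3; have q0 : 0 < q by rewrite ltr_pwDl // divr_ge0.
exists (s / q); first by rewrite divr_ge0 // ltW.
have t3 : s / q < 3 by rewrite ltr_pdivrMr // /q; lra.
have := expR_bernstein (divr_ge0 s0 (ltW q0)) t3.
have -> : (s / q) ^+ 2 / (2 * (1 - s / q / 3)) = s ^+ 2 / (2 * q).
  have -> : 1 - s / q / 3 = q^-1 by rewrite /q; field; move: q0; rewrite /q;
    lra.
  by field; rewrite gt_eqF.
move=> /(ler_wpM2r w0) le_phi; rewrite sw.
apply: (le_trans (lerB le_phi (lexx _))).
have -> : s ^+ 2 / (2 * q) * w = L / q.
  by rewrite mulrAC mulrC [s ^+ 2 * w]mulrC s2; field; rewrite gt_eqF.
have -> : s / q * (w * s + L / 3) = (2 * L + L * s / 3) / q.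
  by rewrite -s2; field; rewrite gt_eqF.
rewrite -mulrBl ler_pdivrMr // /q; lra.
Qed.

(** * Tail bounds for summands built from disjoint blocks of the sample *)

Section block_sums.
Context {R : realType} {disp : measure_display} {T : measurableType disp}.
Variables (P : probability T R) (n : nat) (X : nat -> T -> 'M[R]_n.+1).
Variable K : set nat.
Hypothesis indepX : mx_independent P K X.
Hypothesis randX : forall i, K i -> random_mx (X i).

(** The indices on which the k-th summand depends: c = 1 for the centred matrices, c = 2 for the
    pairs. *)
Definition block (c k : nat) : set nat := [set i | (c * k <= i < c * k.+1)%N].

Variables (c m : nat) (Y : nat -> T -> 'M[R]_n.+1) (v : R).
Hypothesis blockK : forall k, (k < m)%N -> block c k `<=` K.
Hypothesis blockY : forall k, (k < m)%N ->
  bounded_rmx (T := cylinder_type X (block c k)) (Y k).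
Hypothesis symY : forall k, (k < m)%N -> forall w, (Y k w)^T = Y k w.
Hypothesis boundY : forall k, (k < m)%N ->
  forall w a, eigenvalue (Y k w) a -> `|a| <= 1.
Hypothesis meanY : forall k, (k < m)%N -> mx_expectation P (Y k) = 0.
Hypothesis varY : forall k, (k < m)%N ->
  mxle (mx_expectation P (fun w => Y k w ^+ 2)) v%:M.
Hypothesis v0 : 0 <= v.

Lemma cylinder_bounded_rmx_mono (I J : set nat) (Z : T -> 'M[R]_n.+1) :
  I `<=` J -> bounded_rmx (T := cylinder_type X I) Z ->
  bounded_rmx (T := cylinder_type X J) Z.
Proof.
move=> IJ bZ i j; have [mZ bd] := bZ i j; split=> // _ B mB.
have sZ := mZ measurableT B mB.
have sub : cylinders X I `<=` <<s cylinders X J >>.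
  move=> _ [s [C [us sI mC ->]]]; apply: sub_sigma_algebra.
  by exists s, C; split=> // k /sI/IJ.
by apply: (smallest_sub _ sub) sZ; exact: smallest_sigma_algebra.
Qed.

Lemma block_bounded k : (k < m)%N -> bounded_rmx (Y k).
Proof.
move=> km; apply: cylinder_bounded_rmx_sub (blockY km).
by move=> i /(blockK km); exact: randX.
Qed.

(** The first k summands are measurable in the blocks before the k-th, whose union is disjoint from
    it. *)
Lemma block_indep k N t : (k < m)%N ->
  mx_expectation P
    (fun w => pexp N (t *: partial_sum Y k w) * pexp N (t *: Y k w)) =
  mx_expectation P (fun w => pexp N (t *: partial_sum Y k w)) *
  mx_expectation P (fun w => pexp N (t *: Y k w)).
Proof.
move=> km; pose I := \bigcup_(j in `I_k) block c j.
apply: (independent_mx_expectationM (I := I) (J := block c k) indepX randX).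
- by move=> i [j /= jk]; apply: blockK; exact: ltn_trans km.
- exact: blockK.
- apply/disj_setPLR => i [j /= jk] /andP[_ ij] /andP[ki _].
  by have := leq_trans ij (leq_trans (leq_mul (leqnn c) jk) ki); rewrite ltnn.
- apply/bounded_rmx_pexp/bounded_rmxZ; rewrite /partial_sum.
  under eq_fun do rewrite -(big_mkord xpredT (fun i => Y i _)).
  apply: bounded_rmx_sum => i; rewrite mem_index_iota => /andP[_ ik].
  apply: cylinder_bounded_rmx_mono (blockY (ltn_trans ik km)).
  by move=> l li; exists i.
- exact/bounded_rmx_pexp/bounded_rmxZ/blockY.
Qed.

Lemma block_chernoff t s : 0 <= t -> 0 <= s ->
  (P [set w | (s <= lambda_max (partial_sum Y m w))%R] <=
   (n.+1%:R * expR (- (t * s)) * (1 + (expR t - 1 - t) * v) ^+ m)%:E)%E.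
Proof.
move=> t0 s0; apply: matrix_chernoff => //; first exact: block_bounded.
by move=> k N u; exact: block_indep.
Qed.

Lemma block_bernstein L : 0 <= L ->
  (P [set w | (Num.sqrt (2 * (m%:R * v) * L) + L / 3 <=
               lambda_max (partial_sum Y m w))%R] <=
   (n.+1%:R * expR (- L))%:E)%E.
Proof.
move=> L0; have mv0 : 0 <= m%:R * v by rewrite mulr_ge0.
have [t t0 exponent] := bernstein_exponent mv0 L0.
apply: le_trans (block_chernoff t0 _) _.
  by rewrite addr_ge0 ?sqrtr_ge0 ?divr_ge0.
rewrite lee_fin -mulrA ler_wpM2l //.
have phi0 : 0 <= expR t - 1 - t by rewrite -addrA -opprD subr_ge0 expR_ge1Dx.
apply: (@le_trans _ _ (expR (- (t * (Num.sqrt (2 * (m%:R * v) * L) + L / 3))) *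
    expR ((expR t - 1 - t) * v) ^+ m)).
  rewrite ler_wpM2l ?expR_ge0 // lerXn2r ?nnegrE ?expR_ge0 ?expR_ge1Dx //.
  by rewrite addr_ge0 // mulr_ge0.
rewrite -expRM_natl -expRD ler_expR; apply: le_trans exponent.
by rewrite addrC mulrCA.
Qed.

(* Chernoff's bound at [t = e / 2]. *)
Lemma block_tail e : 0 < e -> e <= 1 -> v <= 1 ->
  (P [set w | (m%:R * e <= lambda_max (partial_sum Y m w))%R] <=
   (n.+1%:R * expR (- (e ^+ 2 / 4)) ^+ m)%:E)%E.
Proof.
move=> e0 e1 v1; have t0 : 0 <= e / 2 by rewrite divr_ge0 // ltW.
apply: le_trans (block_chernoff t0 _) _; first by rewrite mulr_ge0 // ltW.
rewrite lee_fin -mulrA ler_wpM2l //.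
have phi0 : 0 <= expR (e / 2) - 1 - e / 2.
  by rewrite -addrA -opprD subr_ge0 expR_ge1Dx.
(* At t = e/2 <= 1/2 the Bernstein bound t^2 / (2 (1 - t/3)) is at most t^2 = e^2/4. The exponent
   per summand is then -e^2/2 + e^2/4. *)
have phi_le : (expR (e / 2) - 1 - e / 2) * v <= e ^+ 2 / 4.
  apply: (@le_trans _ _ (expR (e / 2) - 1 - e / 2)); first by rewrite ler_piMr.
  apply: le_trans (expR_bernstein t0 _) _; first by lra.
  rewrite exprMn expr2 -mulrA ler_pdivrMr; last by lra.
  by have := sqr_ge0 e;
    have : e ^+ 2 * e <= e ^+ 2 by [rewrite ler_piMr ?sqr_ge0|]; nra.
have -> : - (e / 2 * (m%:R * e)) = m%:R * - (e ^+ 2 / 2) by field.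
rewrite expRM_natl -exprMn lerXn2r ?nnegrE ?expR_ge0 //.
  by rewrite mulr_ge0 ?expR_ge0 // addr_ge0 // mulr_ge0.
apply: (@le_trans _ _ (expR (- (e ^+ 2 / 2)) *
    expR ((expR (e / 2) - 1 - e / 2) * v))).
  by rewrite ler_wpM2l ?expR_ge0 ?expR_ge1Dx.
by rewrite -expRD ler_expR; move: phi_le; lra.
Qed.

End block_sums.

(** * Means and variances of the sample *)

Section matrix_sample.
Context {R : realType} {disp : measure_display} {T : measurableType disp}.
Variables (P : probability T R) (n : nat) (X : nat -> T -> 'M[R]_n.+1).
Variables (K : set nat) (M V : 'M[R]_n.+1).
Hypothesis sampleX : sample_hypotheses P K X M V.

Let randX i : K i -> random_mx (X i).
Proof. by have [h _ _ _ _] := sampleX; exact: h. Qed.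

Let symX i : K i -> forall w, (X i w)^T = X i w.
Proof. by have [_ h _ _ _] := sampleX; exact: h. Qed.

Let eigX i : K i -> forall w a, eigenvalue (X i w) a -> 0 <= a <= 1.
Proof. by have [_ _ h _ _] := sampleX; exact: h. Qed.

Let meanX i : K i -> mx_expectation P (X i) = M.
Proof. by have [_ _ _ h _] := sampleX; move=> /h[]. Qed.

Let varX i : K i -> mx_expectation P (fun w => (X i w - M) ^+ 2) = V.
Proof. by have [_ _ _ h _] := sampleX; move=> /h[]. Qed.

Let indepX : mx_independent P K X.
Proof. by have [_ _ _ _ h] := sampleX. Qed.

Lemma mxle0_sample i w : K i -> mxle 0 (X i w) /\ mxle (X i w) 1%:M.
Proof.
move=> Ki; have [lo up] := mxle_eigenvalues (symX Ki w) (eigX Ki (w := w)).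
by split=> //; rewrite -scalemx1 scale0r in lo.
Qed.

(** A^2 <= 1, and its i-th diagonal entry is the sum of the squares of row i. This turns the
    spectral hypothesis on the sample into bounded entries, hence integrability. *)
Lemma mx_entry_le1 (A : 'M[R]_n.+1) i j : A^T = A -> mxle 0 A -> mxle A 1%:M ->
  `|A i j| <= 1.
Proof.
move=> symA A0 A1.
have AA1 : mxle (A ^+ 2) 1%:M.
  have := @mxle_horner _ _ A ('X ^+ 2) 1%:P symA.
  rewrite rmorphXn /= horner_mx_X horner_mx_C; apply=> a eig_a.
  rewrite !hornerE expr_le1 ?(eigenvalue_mxle A1) //
      (eigenvalue_mxge (A := A)) //.
  by rewrite -scalemx1 scale0r.
have row_sqr : \sum_k A i k ^+ 2 <= 1.
  have qdelta (B : 'M[R]_n.+1) : qform B (delta_mx 0 i) = B i i.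
    by rewrite /qform trmx_delta -rowE -colE !mxE.
  have := AA1 (delta_mx 0 i); rewrite !qdelta [in X in _ <= X]mxE eqxx.
  apply: le_trans; rewrite expr2 -mulmxE mxE; apply: ler_sum => k _.
  by have -> : A k i = A i k by rewrite -[in RHS]symA mxE.
have sq1 : A i j ^+ 2 <= 1.
  by apply: le_trans row_sqr; rewrite (bigD1 j) //= lerDl sumr_ge0 // => k _;
    rewrite sqr_ge0.
by rewrite -(@expr_le1 _ 2) // real_normK ?num_real.
Qed.

Lemma sample_bounded (J : set nat) i : K i -> J i ->
  bounded_rmx (T := cylinder_type X J) (X i).
Proof.
move=> Ki Ji; apply: (@cylinder_bounded_rmx _ _ _ _ _ _ _ 1) => // w k l.
by have [lo up] := mxle0_sample w Ki; apply: mx_entry_le1 => //; exact: symX.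
Qed.

Lemma sample_bddX i : K i -> bounded_rmx (X i).
Proof.
move=> Ki; apply: (@cylinder_bounded_rmx_sub _ _ _ _ X [set i]).
  by move=> _ ->; exact: randX.
exact: sample_bounded.
Qed.

Section first_moments.
Variable i : nat.
Hypothesis Ki : K i.

Lemma mean_sym : M^T = M.
Proof. by rewrite -(meanX Ki); apply: mx_expectation_sym; exact: symX. Qed.

Lemma mean_bounds : mxle 0 M /\ mxle M 1%:M.
Proof.
rewrite -(meanX Ki) -{1}(mx_expectation_cst P 0) -(mx_expectation_cst P 1%:M).
have bX := sample_bddX Ki; have bc A := bounded_rmx_cst A.
by split; apply: mx_expectation_mxle => // w; have [] := mxle0_sample w Ki.
Qed.

Lemma center_sym w : (X i w - M)^T = X i w - M.
Proof. by rewrite linearB /= symX // mean_sym. Qed.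

Lemma variance_sym : V^T = V.
Proof.
rewrite -(varX Ki); apply: mx_expectation_sym => w.
by rewrite trmx_expr center_sym.
Qed.

Lemma mxle0_sqr (A : 'M[R]_n.+1) : A^T = A -> mxle 0 (A ^+ 2).
Proof.
move=> symA u;
  rewrite expr2 -mulmxE -[X in _ *m X]mul1mx mulmxA qform_mul_sym //.
by rewrite qform0 qform1_ge0.
Qed.

Lemma variance_psd : mxle 0 V.
Proof.
rewrite -(varX Ki) -{1}(mx_expectation_cst P 0).
apply: mx_expectation_mxle; first exact: bounded_rmx_cst.
  by apply/bounded_rmxX/bounded_rmxB/bounded_rmx_cst; exact: sample_bddX.
by move=> w; apply/mxle0_sqr/center_sym.
Qed.

Lemma center_mean : mx_expectation P (fun w => X i w - M) = 0.
Proof.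
rewrite mx_expectationB; [|exact: sample_bddX|exact: bounded_rmx_cst].
by rewrite mx_expectation_cst meanX // subrr.
Qed.

Lemma mxle_sub_norm (A B : 'M[R]_n.+1) a : mxle 0 A -> mxle A 1%:M ->
  mxle 0 B -> mxle B 1%:M -> eigenvalue (A - B) a -> `|a| <= 1.
Proof.
move=> A0 A1 B0 B1 eig; rewrite ler_norml.
apply/andP; split.
  apply: eigenvalue_mxge eig => u; rewrite -scalemx1 qformZ qformB.
  by have := A0 u; have := B1 u; rewrite qform0; lra.
apply: eigenvalue_mxle eig => u; rewrite qformB.
by have := A1 u; have := B0 u; rewrite qform0; lra.
Qed.

Lemma center_eigenvalue w a : eigenvalue (X i w - M) a -> `|a| <= 1.
Proof.
have [A0 A1] := mxle0_sample w Ki; have [B0 B1] := mean_bounds.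
exact: mxle_sub_norm.
Qed.

Lemma second_moment : mx_expectation P (fun w => X i w ^+ 2) = V + M ^+ 2.
Proof.
have bX := sample_bddX Ki.
have bMX : bounded_rmx (fun w => M * X i w).
  by apply: bounded_rmxM => //; exact: bounded_rmx_cst.
have bXM : bounded_rmx (fun w => X i w * M).
  by apply: bounded_rmxM => //; exact: bounded_rmx_cst.
have bc A := @bounded_rmx_cst R _ T n A.
rewrite -(varX Ki).
have -> : (fun w => (X i w - M) ^+ 2) =
    (fun w => X i w ^+ 2 - X i w * M - M * X i w + M ^+ 2).
  apply/funext => w; rewrite !expr2 mulrBl !mulrBr opprB addrA.
  by rewrite -!addrA; congr (_ + (_ + _)); rewrite addrC.
have bX2 := bounded_rmxX 2 bX.
rewrite mx_expectationD //; last by apply: bounded_rmxB => //;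
  exact: bounded_rmxB.
rewrite mx_expectationB //; last exact: bounded_rmxB.
rewrite mx_expectationB // mx_expectation_cst mx_expectationMr //
  mx_expectationMl //.
by rewrite meanX // -expr2 !subrK.
Qed.

End first_moments.

Section paired.
Variables i j : nat.
Hypotheses (Ki : K i) (Kj : K j) (ij : i != j).

Let Z w := (X i w - X j w) ^+ 2.

Lemma paired_sub_sym w : (X i w - X j w)^T = X i w - X j w.
Proof. by rewrite linearB /= !symX. Qed.

Lemma paired_sym w : (Z w)^T = Z w.
Proof. by rewrite /Z trmx_expr paired_sub_sym. Qed.

Lemma paired_bounded : bounded_rmx Z.
Proof. by apply/bounded_rmxX/bounded_rmxB; exact: sample_bddX. Qed.

(** In the expanded square the two cross terms have mean M^2 by independence and the two squares V +
    M^2, so M^2 cancels. *)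
Lemma paired_mean : mx_expectation P Z = 2 *: V.
Proof.
have bXi := sample_bddX Ki; have bXj := sample_bddX Kj.
have indep a b : K a -> K b -> a != b ->
    mx_expectation P (fun w => X a w * X b w) = M ^+ 2.
  move=> Ka Kb ab; rewrite expr2 -{1}(meanX Ka) -(meanX Kb).
  apply: (independent_mx_expectationM (I := [set a]) (J := [set b]) indepX
      randX).
  - by move=> _ ->.
  - by move=> _ ->.
  - by apply/disj_setPLR => _ -> /= /eqP; rewrite (negbTE ab).
  - exact: sample_bounded.
  - exact: sample_bounded.
have bij := bounded_rmxM bXi bXj; have bji := bounded_rmxM bXj bXi.
have bi2 := bounded_rmxX 2 bXi; have bj2 := bounded_rmxX 2 bXj.
have -> : Z = (fun w => X i w ^+ 2 - X i w * X j w - X j w * X i w + X j w ^+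
  2).
  apply/funext => w; rewrite /Z !expr2 mulrBl !mulrBr opprB addrA.
  by rewrite -!addrA; congr (_ + (_ + _)); rewrite addrC.
rewrite mx_expectationD //; last by apply: bounded_rmxB => //;
  exact: bounded_rmxB.
rewrite mx_expectationB //; last exact: bounded_rmxB.
have ji : j != i by rewrite eq_sym.
rewrite mx_expectationB // (indep i j) // (indep j i) //.
rewrite (second_moment Ki) (second_moment Kj).
by rewrite addrK [V + M ^+ 2]addrC addrA subrK scaler_nat mulr2n.
Qed.

Lemma paired_bounds w : mxle 0 (Z w) /\ mxle (Z w) 1%:M.
Proof.
split; first exact/mxle0_sqr/paired_sub_sym.
rewrite /Z.
have := @mxle_horner _ _ (X i w - X j w) ('X ^+ 2) 1%:P (paired_sub_sym w).
rewrite rmorphXn /= horner_mx_X horner_mx_C; apply=> a eig_a.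
have [A0 A1] := mxle0_sample w Ki; have [B0 B1] := mxle0_sample w Kj.
have := mxle_sub_norm A0 A1 B0 B1 eig_a.
by rewrite !hornerE -real_normK ?num_real // expr_le1.
Qed.

Lemma twice_variance_bounds : mxle 0 (2 *: V) /\ mxle (2 *: V) 1%:M.
Proof.
rewrite -paired_mean -{1}(mx_expectation_cst P 0) -(mx_expectation_cst P 1%:M).
have bZ := paired_bounded; have bc A := bounded_rmx_cst A.
by split; apply: mx_expectation_mxle => // w; have [] := paired_bounds w.
Qed.

(** E(2V - Z)^2 = E Z^2 - (2V)^2 <= E Z^2, and Z^2 <= Z because 0 <= Z <= 1, so E Z^2 <= E Z =
    2V. *)
Lemma paired_center_var :
  mxle (mx_expectation P (fun w => (2 *: V - Z w) ^+ 2))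
      (2 * spectral_norm V)%:M.
Proof.
have symV := variance_sym Ki.
have sym2V : (2 *: V)^T = 2 *: V by rewrite linearZ /= symV.
have bZ := paired_bounded; have bc A := @bounded_rmx_cst R _ T n A.
have bZ2 := bounded_rmxX 2 bZ.
have bWZ : bounded_rmx (fun w => 2 *: V * Z w) by exact: bounded_rmxM.
have bZW : bounded_rmx (fun w => Z w * (2 *: V)) by exact: bounded_rmxM.
have -> : (fun w => (2 *: V - Z w) ^+ 2) =
    (fun w => Z w ^+ 2 - Z w * (2 *: V) - 2 *: V * Z w + (2 *: V) ^+ 2).
  apply/funext => w; rewrite -(opprB (Z w)) sqrrN.
  move: (2 *: V) (Z w) => W z; rewrite !expr2 mulrBl !mulrBr opprB addrA.
  by rewrite -!addrA; congr (_ + (_ + _)); rewrite addrC.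
rewrite mx_expectationD //; last by apply: bounded_rmxB => //;
  exact: bounded_rmxB.
rewrite mx_expectationB //; last exact: bounded_rmxB.
rewrite mx_expectationB // mx_expectation_cst mx_expectationMr //
  mx_expectationMl //.
rewrite paired_mean -expr2 subrK => u; rewrite qformB.
have := mxle0_sqr sym2V u.
rewrite qform0 => sq0.
have ZZ : mxle (mx_expectation P (fun w => Z w ^+ 2)) (2 *: V).
  rewrite -paired_mean; apply: mx_expectation_mxle => // w.
  have [Z0 Z1] := paired_bounds w.
  have := @mxle_horner _ _ (Z w) ('X ^+ 2) 'X (paired_sym w).
  rewrite rmorphXn /= horner_mx_X; apply=> a eig_a.
  have a1 := eigenvalue_mxle Z1 eig_a.
  have a0 : 0 <= a by apply: eigenvalue_mxge eig_a; rewrite -scalemx1 scale0r.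
  by rewrite !hornerE expr2 ler_piMr.
have := ZZ u; have := mxle_spectral_norm symV u.
rewrite -[(2 * _)%:M]scalemx1 -[(spectral_norm V)%:M]scalemx1 !qformZ.
by move: sq0; lra.
Qed.

End paired.

Lemma center_bernstein m L : (0 < m)%N -> (forall k, (k < m)%N -> K k) ->
  0 <= L ->
  (P [set w | (Num.sqrt (2 * (m%:R * spectral_norm V) * L) + L / 3 <=
               lambda_max (partial_sum (fun k w => X k w - M) m w))%R] <=
   (n.+1%:R * expR (- L))%:E)%E.
Proof.
move=> m0 mK L0.
apply: (@block_bernstein _ _ _ _ _ _ _ indepX randX 1) => //.
- by move=> k km i; rewrite /block /= !mul1n ltnS -eqn_leq => /eqP <-;
  exact: mK.
- move=> k /mK Kk; apply: bounded_rmxB; last exact: bounded_rmx_cst.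
  by apply: sample_bounded => //; rewrite /block /= !mul1n ltnS leqnn.
- by move=> k /mK Kk w; exact: center_sym.
- by move=> k /mK Kk w a; exact: center_eigenvalue.
- by move=> k /mK Kk; exact: center_mean.
- by move=> k /mK Kk; rewrite varX //;
  exact/mxle_spectral_norm/(variance_sym Kk).
- exact/spectral_norm_ge0/(variance_sym (mK _ m0)).
Qed.

(** The sign s = 1 detects underestimation of V and s = -1 overestimation; the finite-sample bound
    uses the former, the limit both. *)
Definition paired_deviation (s : R) k w := s *:
  (2 *: V - (X k.*2 w - X k.*2.+1 w) ^+ 2).

Section paired_sums.
Variable m : nat.
Hypothesis m0 : (0 < m)%N.
Hypothesis mK : forall k, (k < m)%N -> K k.*2 /\ K k.*2.+1.

Let neq2 k : k.*2 != k.*2.+1. Proof. by rewrite ltn_eqF. Qed.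

Let symV : V^T = V.
Proof. exact: variance_sym (mK m0).1. Qed.

Let block2 k : block 2 k k.*2 /\ block 2 k k.*2.+1.
Proof.
by rewrite /block /= !mul2n doubleS leqnn leqnSn !ltnS leqnn leqnSn.
Qed.

Let paired_block k : (k < m)%N -> block 2 k `<=` K.
Proof.
move=> /mK[K0 K1] i; rewrite /block /= !mul2n doubleS !ltnS => /andP[lo].
rewrite leq_eqVlt => /orP[/eqP->//|]; rewrite ltnS => up.
by have /eqP <- : k.*2 == i by rewrite eqn_leq lo.
Qed.

Let paired_cylinder s k : (k < m)%N ->
  bounded_rmx (T := cylinder_type X (block 2 k)) (paired_deviation s k).
Proof.
move=> /mK[K0 K1]; have [b0 b1] := block2 k.
apply/bounded_rmxZ/bounded_rmxB; first exact: bounded_rmx_cst.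
by apply/bounded_rmxX/bounded_rmxB; exact: sample_bounded.
Qed.

Let paired_dev_sym s k : (k < m)%N -> forall w,
  (paired_deviation s k w)^T = paired_deviation s k w.
Proof.
by move=> /mK[K0 K1] w; rewrite linearZ linearB /= linearZ /= symV paired_sym.
Qed.

Let paired_dev_eig s k : `|s| = 1 -> (k < m)%N ->
  forall w a, eigenvalue (paired_deviation s k w) a -> `|a| <= 1.
Proof.
move=> s1 /mK[K0 K1] w a /eigenvalueP[u uA u0].
have ss : s * s = 1 by rewrite -expr2 -real_normK ?num_real // s1 expr1n.
have [A0 A1] := twice_variance_bounds K0 K1 (neq2 k).
have [B0 B1] := paired_bounds K0 K1 w.
have eig : eigenvalue (2 *: V - (X k.*2 w - X k.*2.+1 w) ^+ 2) (s * a).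
  apply/eigenvalueP; exists u => //; rewrite -scalerA -uA -scalemxAr scalerA.
  by rewrite ss scale1r.
by have := mxle_sub_norm A0 A1 B0 B1 eig; rewrite normrM s1 mul1r.
Qed.

Let paired_dev_mean s k : (k < m)%N ->
  mx_expectation P (paired_deviation s k) = 0.
Proof.
move=> /mK[K0 K1]; have bZ := paired_bounded K0 K1.
rewrite mx_expectationZ; last by apply: bounded_rmxB => //;
  exact: bounded_rmx_cst.
rewrite mx_expectationB //; last exact: bounded_rmx_cst.
by rewrite mx_expectation_cst paired_mean // subrr scaler0.
Qed.

Let paired_dev_var s k : `|s| = 1 -> (k < m)%N ->
  mxle (mx_expectation P (fun w => paired_deviation s k w ^+ 2))
       (2 * spectral_norm V)%:M.
Proof.
move=> s1 /mK[K0 K1]; have := paired_center_var K0 K1 (neq2 k).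
have ss : s * s = 1 by rewrite -expr2 -real_normK ?num_real // s1 expr1n.
suff -> : (fun w => paired_deviation s k w ^+ 2) =
  (fun w => (2 *: V - (X k.*2 w - X k.*2.+1 w) ^+ 2) ^+ 2) by [].
apply/funext => w; rewrite /paired_deviation expr2 -scalerAl -scalerAr scalerA.
by rewrite ss scale1r.
Qed.

Let norm2_ge0 : 0 <= 2 * spectral_norm V.
Proof. by rewrite mulr_ge0 // spectral_norm_ge0. Qed.

(** Supplies the condition v <= 1 of [block_tail]: 2V is the mean of a squared difference lying
    between 0 and 1. *)
Lemma twice_norm_le1 : 2 * spectral_norm V <= 1.
Proof.
have [K0 K1] := mK m0.
have [A0 A1] := twice_variance_bounds K0 K1 (neq2 0).
suff : spectral_norm V <= 2^-1 by lra.
apply: spectral_norm_le => // u.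
  have := A0 u; have := qform1_ge0 u.
  by rewrite -[(- _)%:M]scalemx1 !qformZ qform0; lra.
by have := A1 u; rewrite -[(2^-1)%:M]scalemx1 !qformZ; lra.
Qed.

Lemma paired_bernstein L : 0 <= L ->
  (P [set w | (Num.sqrt (2 * (m%:R * (2 * spectral_norm V)) * L) + L / 3 <=
               lambda_max (partial_sum (paired_deviation 1) m w))%R] <=
   (n.+1%:R * expR (- L))%:E)%E.
Proof.
move=> L0; apply: (@block_bernstein _ _ _ _ _ _ _ indepX randX 2) => //.
- exact: paired_cylinder.
- exact: paired_dev_sym.
- by move=> k; apply: paired_dev_eig; rewrite normr1.
- exact: paired_dev_mean.
- by move=> k; apply: paired_dev_var; rewrite normr1.
Qed.

Lemma paired_tail s e : `|s| = 1 -> 0 < e -> e <= 1 ->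
  (P [set w | (m%:R * e <= lambda_max
      (partial_sum (paired_deviation s) m w))%R] <=
   (n.+1%:R * expR (- (e ^+ 2 / 4)) ^+ m)%:E)%E.
Proof.
move=> s1 e0 e1.
apply: (@block_tail _ _ _ _ _ _ _ indepX randX 2 _ _ (2 * spectral_norm V)) =>
  //.
- exact: paired_cylinder.
- exact: paired_dev_sym.
- by move=> k; exact: paired_dev_eig.
- exact: paired_dev_mean.
- by move=> k; exact: paired_dev_var.
- exact: twice_norm_le1.
Qed.

End paired_sums.
End matrix_sample.

(** * The finite-sample bound *)

(** Here s = ||V||, S = ||V_n^*||, and l1, l2 are the largest eigenvalues of the two deviations.
    With u = sqrt s, U = sqrt S and e = sqrt (L2/N), the bound on l2 gives u^2 <= U^2 + sqrt 2 e u +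
    e^2/3. Doubling and completing the square, (sqrt 2 u - e)^2 <= 2 U^2 + (1 + 2/3) e^2, so sqrt 2
    u <= sqrt 2 U + (sqrt (5/3) + 1) e. Multiplying by a = sqrt (L/N) gives the last two terms of
    D_n. *)
Lemma deviation_transfer (R : realType) (N L L2 L3 s S l1 l2 : R) :
  0 < N -> 0 <= L -> 0 <= L2 <= L3 -> 0 <= s -> 0 <= S -> s <= S + l2 ->
  N * l1 < Num.sqrt (2 * (N * s) * L) + L / 3 ->
  N * l2 < Num.sqrt (2 * (N * s) * L2) + L2 / 3 ->
  l1 < L / (3 * N) + Num.sqrt (2 * S * L / N)
       + (Num.sqrt (5 / 3) + 1) * (Num.sqrt (L * L3) / N).
Proof.
move=> N0 L0 /andP[L20 L23] s0 S0 sS h1 h2.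
have Nn0 : N != 0 by rewrite gt_eqF.
have iN0 : 0 <= N^-1 by rewrite invr_ge0 ltW.
pose a := Num.sqrt (L / N); pose e := Num.sqrt (L2 / N).
pose u := Num.sqrt s; pose U := Num.sqrt S.
pose r := Num.sqrt (2 : R); pose c := Num.sqrt (5 / 3 : R).
have a0 : 0 <= a by rewrite sqrtr_ge0. have e0 : 0 <= e by rewrite sqrtr_ge0.
have u0 : 0 <= u by rewrite sqrtr_ge0. have U0 : 0 <= U by rewrite sqrtr_ge0.
have r0 : 0 <= r by rewrite sqrtr_ge0. have c0 : 0 <= c by rewrite sqrtr_ge0.
have a2 : a ^+ 2 = L / N by rewrite sqr_sqrtr // divr_ge0 // ltW.
have e2 : e ^+ 2 = L2 / N by rewrite sqr_sqrtr // divr_ge0 // ltW.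
have u2 : u ^+ 2 = s by rewrite sqr_sqrtr.
have U2 : U ^+ 2 = S by rewrite sqr_sqrtr.
have r2 : r ^+ 2 = 2 by rewrite sqr_sqrtr.
have c2 : c ^+ 2 = 5 / 3 by rewrite sqr_sqrtr // divr_ge0.
have sqrtE (x y : R) : 0 <= y -> x = y ^+ 2 -> Num.sqrt x = y.
  by move=> y0 ->; rewrite sqrtr_sqr ger0_norm.
have LE : L = N * a ^+ 2 by rewrite a2 mulrC divfK.
have L2E : L2 = N * e ^+ 2 by rewrite e2 mulrC divfK.
have E1 : Num.sqrt (2 * (N * s) * L) = N * (r * a * u).
  apply: sqrtE; first by rewrite !mulr_ge0 // ltW.
  by rewrite -r2 -u2 LE; ring.
have E2 : Num.sqrt (2 * (N * s) * L2) = N * (r * e * u).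
  apply: sqrtE; first by rewrite !mulr_ge0 // ltW.
  by rewrite -r2 -u2 L2E; ring.
have E3 : Num.sqrt (2 * S * L / N) = r * U * a.
  apply: sqrtE; first by rewrite !mulr_ge0.
  by rewrite -r2 -U2 LE; field.
have E4 : a * e <= Num.sqrt (L * L3) / N.
  have -> : a * e = Num.sqrt (L * L2) / N.
    rewrite (sqrtE (L * L2) (N * (a * e))); first by field.
      by rewrite !mulr_ge0 // ltW.
    by rewrite LE L2E; ring.
  by rewrite ler_wpM2r // ler_wsqrtr // ler_wpM2l.
have h1' : l1 < r * a * u + a ^+ 2 / 3.
  by rewrite -(ltr_pM2l N0); move: h1; rewrite E1 LE; lra.
have h2' : l2 < r * e * u + e ^+ 2 / 3.
  by rewrite -(ltr_pM2l N0); move: h2; rewrite E2 L2E; lra.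
have key : r * u - e <= r * U + c * e.
  (* A nonpositive left side is trivial; otherwise both sides are squared and the cross term on the
     right is dropped. *)
  have [neg|pos] := leP (r * u - e) 0.
    by apply: (le_trans neg); rewrite addr_ge0 // mulr_ge0.
  rewrite -(@ler_pXn2r _ 2) ?nnegrE ?(ltW pos) ?addr_ge0 ?mulr_ge0 //.
  have : (r * u - e) ^+ 2 <= 2 * U ^+ 2 + c ^+ 2 * e ^+ 2.
    rewrite sqrrB exprMn r2 c2.
    have := lt_le_trans h2' (lexx _); move: sS; rewrite -u2 -U2; lra.
  move=> /le_trans; apply; rewrite sqrrD !exprMn r2 -addrA lerD2l lerDr.
  by rewrite mulrn_wge0 // !mulr_ge0.
have := ler_wpM2l a0 key; rewrite E3 -/c.
have -> : L / (3 * N) = a ^+ 2 / 3 by rewrite a2; field.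
have := ler_wpM2l (addr_ge0 c0 ler01) E4; move: h1'; lra.
Qed.

Section statistics.
Context {R : realType} {disp : measure_display} {T : measurableType disp}.
Variables (P : probability T R) (n : nat) (X : nat -> T -> 'M[R]_n.+1).
Variables (K : set nat) (M V : 'M[R]_n.+1).

Lemma partial_sum_center N w : (0 < N)%N ->
  partial_sum (fun k w => X k w - M) N w =
  N%:R *: (sample_average N (X ^~ w) - M).
Proof.
move=> N0; rewrite /partial_sum sumrB sumr_const card_ord scalerBr.
by rewrite scalerA mulfV ?scale1r ?scaler_nat // pnatr_eq0 -lt0n.
Qed.

(** Dividing the sum of m squares, each of mean 2V, by n = 2m rather than by m is what centres V_n^*
    at V. *)
Lemma partial_sum_paired s m w : (0 < m)%N ->
  partial_sum (paired_deviation X V s) m w =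
  (m.*2)%:R *: (s *: (V - paired_variance m.*2 (X ^~ w))).
Proof.
move=> m0; rewrite /partial_sum -scaler_sumr scalerA mulrC -scalerA;
  congr (_ *: _).
rewrite sumrB sumr_const card_ord scalerBr /paired_variance doubleK.
rewrite scalerA mulfV ?scale1r ?pnatr_eq0 ?double_eq0 -?lt0n //.
by rewrite -scaler_nat scalerA -mul2n natrM mulrC.
Qed.

Hypothesis sampleX : sample_hypotheses P K X M V.

Let symX i : K i -> forall w, (X i w)^T = X i w.
Proof. by have [_ h _ _ _] := sampleX; exact: h. Qed.

Section finite_sample.
Variable m : nat.
Hypothesis m0 : (0 < m)%N.
Hypothesis mK : forall k, (k < m.*2)%N -> K k.

Let pairK k : (k < m)%N -> K k.*2 /\ K k.*2.+1.
Proof.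
move=> km; split; apply: mK; first by rewrite ltn_double.
by rewrite -doubleS leq_double.
Qed.

Let K0 : K 0%N.
Proof. by apply: mK; rewrite double_gt0. Qed.
Let symM : M^T = M. Proof. exact: (mean_sym sampleX K0). Qed.
Let symV : V^T = V. Proof. exact: (variance_sym sampleX K0). Qed.

Lemma sample_average_sym w : (sample_average m.*2 (X ^~ w))^T =
  sample_average m.*2 (X ^~ w).
Proof.
rewrite linearZ /= linear_sum; congr (_ *: _); apply: eq_bigr => i _.
exact: symX (mK (ltn_ord i)) w.
Qed.

Lemma paired_variance_sym w : (paired_variance m.*2 (X ^~ w))^T =
  paired_variance m.*2 (X ^~ w).
Proof.
rewrite /paired_variance doubleK linearZ /= linear_sum; congr (_ *: _);
  apply: eq_bigr => i _.
by have [Ka Kb] := pairK (ltn_ord i); exact: (paired_sym sampleX).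
Qed.

Lemma paired_variance_psd w : mxle 0 (paired_variance m.*2 (X ^~ w)).
Proof.
move=> u; rewrite /paired_variance doubleK qform0 qformZ.
rewrite mulr_ge0 ?invr_ge0 //.
elim/big_ind: _ => [|A B A0 B0|i _]; first by rewrite qform0.
  by rewrite qformD addr_ge0.
have [Ka Kb] := pairK (ltn_ord i).
by have [/(_ u)] := paired_bounds sampleX Ka Kb w; rewrite qform0.
Qed.

Lemma sample_average_bounded :
  bounded_rmx (fun w => sample_average m.*2 (X ^~ w)).
Proof.
apply: bounded_rmxZ;
  under eq_fun do rewrite -(big_mkord xpredT (fun i => X i _)).
apply: bounded_rmx_sum => i; rewrite mem_index_iota => /andP[_ im].
exact: (sample_bddX sampleX (mK im)).
Qed.

Lemma paired_variance_bounded :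
  bounded_rmx (fun w => paired_variance m.*2 (X ^~ w)).
Proof.
rewrite /paired_variance doubleK; apply: bounded_rmxZ.
under eq_fun do rewrite
  -(big_mkord xpredT (fun i => (X i.*2 _ - X i.*2.+1 _) ^+ 2)).
apply: bounded_rmx_sum => i; rewrite mem_index_iota => /andP[_ im].
by have [Ka Kb] := pairK im; exact: (paired_bounded sampleX).
Qed.

Lemma measurable_center_lambda_max : measurable_fun [set: T]
  (fun w => lambda_max (sample_average m.*2 (X ^~ w) - M)).
Proof.
apply: measurable_lambda_max.
  by apply: bounded_rmxB;
    [exact: sample_average_bounded|exact: bounded_rmx_cst].
by move=> w; rewrite linearB /= sample_average_sym symM.
Qed.

Lemma measurable_paired_lambda_max s : measurable_fun [set: T]
  (fun w => lambda_max (s *: (V - paired_variance m.*2 (X ^~ w)))).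
Proof.
apply: measurable_lambda_max.
  apply/bounded_rmxZ/bounded_rmxB; first exact: bounded_rmx_cst.
  exact: paired_variance_bounded.
by move=> w; rewrite linearZ linearB /= symV paired_variance_sym.
Qed.

Lemma measurable_deviation_bound alpha : measurable_fun [set: T]
  (fun w => deviation_bound alpha m.*2 (X ^~ w)).
Proof.
have mnorm : measurable_fun [set: T]
    (fun w => spectral_norm (paired_variance m.*2 (X ^~ w))).
  by apply: measurable_spectral_norm;
    [exact: paired_variance_bounded|exact: paired_variance_sym].
apply: measurable_funD; last exact: measurable_cst.
apply: measurable_funD; first exact: measurable_cst.
apply: measurableT_comp;
  first exact: (continuous_measurable_fun (@sqrt_continuous R)).
apply: measurable_funM; last exact: measurable_cst.
apply: measurable_funM; last exact: measurable_cst.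
by apply: measurable_funM => //; exact: measurable_cst.
Qed.

Lemma finite_sample_bound alpha : 0 < alpha < 1 ->
  (P [set w | (lambda_max (sample_average m.*2 (X ^~ w) - M)
               >= deviation_bound alpha m.*2 (X ^~ w))%R] <= alpha%:E)%E.
Proof.
move=> /andP[alpha0 alpha1].
set N : R := (m.*2)%:R; set d : R := n.+1%:R.
have N2 : 2 <= N by rewrite ler_nat -[2%N]/(1.*2)%N leq_double.
have N0 : 0 < N by lra.
have N10 : 0 < N - 1 by lra.
have d1 : 1 <= d by rewrite ler1n.
have d0 : 0 < d by lra.
(* The level is split unevenly: d e^(-L) = (n-1) alpha / n is spent on the mean and d e^(-L2) =
   alpha / n on the variance estimate. L3 >= L2 is the logarithm occurring in D_n. *)
pose L := ln (N * d / ((N - 1) * alpha)).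
pose L2 := ln (N * d / alpha).
pose L3 := ln (2 * N * d / alpha).
have x1 : 1 <= N * d / ((N - 1) * alpha).
  rewrite ler_pdivlMr ?mulr_gt0 // mul1r.
  have := ler_pM (ltW N10) (ltW alpha0) (_ : N - 1 <= N) (ltW alpha1).
  have := ler_wpM2l (ltW N0) d1; nra.
have x2 : 1 <= N * d / alpha.
  by rewrite ler_pdivlMr // mul1r; have := ler_wpM2l (ltW N0) d1; nra.
have L0 : 0 <= L by exact: ln_ge0.
have L20 : 0 <= L2 by exact: ln_ge0.
have L23 : L2 <= L3.
  have x0 : 0 < N * d / alpha by rewrite (lt_le_trans ltr01).
  rewrite ler_ln ?posrE //; last by rewrite -!mulrA mulr_gt0 // mulrA.
  by rewrite -!mulrA; lra.
pose A1 := [set w | Num.sqrt (2 * (N * spectral_norm V) * L) + L / 3 <=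
  lambda_max (partial_sum (fun k w => X k w - M) m.*2 w)].
pose A2 := [set w |
  Num.sqrt (2 * (m%:R * (2 * spectral_norm V)) * L2) + L2 / 3 <=
  lambda_max (partial_sum (paired_deviation X V 1) m w)].
have psumA w : lambda_max (partial_sum (fun k w => X k w - M) m.*2 w) =
    N * lambda_max (sample_average m.*2 (X ^~ w) - M).
  rewrite partial_sum_center ?double_gt0 // lambda_maxZ //.
  by rewrite linearB /= sample_average_sym symM.
have psumB w : lambda_max (partial_sum (paired_deviation X V 1) m w) =
    N * lambda_max (1 *: (V - paired_variance m.*2 (X ^~ w))).
  rewrite partial_sum_paired // lambda_maxZ //.
  by rewrite linearZ linearB /= symV paired_variance_sym.
have mA1 : measurable A1.
  rewrite -[A1]setTI; apply: measurable_fun_le => //.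
  under eq_fun do rewrite psumA; apply: measurable_funM;
    first exact: measurable_cst.
  exact: measurable_center_lambda_max.
have mA2 : measurable A2.
  rewrite -[A2]setTI; apply: measurable_fun_le => //.
  under eq_fun do rewrite psumB; apply: measurable_funM;
    first exact: measurable_cst.
  exact: measurable_paired_lambda_max.
set D := [set w | _].
have mD : measurable D.
  rewrite -[D]setTI; apply: measurable_fun_le => //.
    exact: measurable_deviation_bound.
  exact: measurable_center_lambda_max.
have sub : D `<=` A1 `|` A2.
  move=> w /= Dw; apply: contrapT => /not_orP[/negP + /negP].
  rewrite -!ltNge psumA psumB scale1r => h1 h2.
  move: Dw; apply/negP; rewrite -ltNge /deviation_bound -/N -/d -/L -/L3.
  apply: (deviation_transfer N0 L0 (_ : 0 <= L2 <= L3) _ _ _ h1 (l2 :=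
    lambda_max (V - paired_variance m.*2 (X ^~ w)))).
  - by rewrite L20 L23.
  - exact: spectral_norm_ge0.
  - exact/spectral_norm_ge0/paired_variance_sym.
  - apply: spectral_norm_sub => //; first exact: paired_variance_sym.
    exact: (variance_psd sampleX K0).
  (* The m = n/2 pairs, with variance bound 2||V|| each, have the same total n||V|| as the n centred
     matrices. *)
  - rewrite (_ : N * spectral_norm V = m%:R * (2 * spectral_norm V)) //.
    by rewrite /N -mul2n natrM mulrCA mulrA.
have PA1 : (P A1 <= (d * expR (- L))%:E)%E.
  by apply: (center_bernstein sampleX) => //; rewrite double_gt0.
have PA2 : (P A2 <= (d * expR (- L2))%:E)%E.
  by apply: (paired_bernstein sampleX) => // k km; have [] := pairK km.
apply: (@le_trans _ _ (P (A1 `|` A2))).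
  exact: (le_measure P (mem_set mD) (mem_set (measurableU _ _ mA1 mA2)) sub).
apply: (le_trans (measureU2 _ mA1 mA2)); apply: (le_trans (leeD PA1 PA2)).
rewrite -EFinD lee_fin !expRN !lnK ?posrE ?(lt_le_trans ltr01) //.
rewrite le_eqVlt; apply/orP; left; apply/eqP; field.
by rewrite !gt_eqF.
Qed.

End finite_sample.
End statistics.

(** * The almost sure limit *)

Section almost_sure_convergence.
Context {R : realType} {disp : measure_display} {T : measurableType disp}.
Variables (P : probability T R).

Lemma ae_eventually_not (F : nat -> set T) (c q : R) :
  (forall k, measurable (F k)) -> 0 <= c -> 0 <= q -> q < 1 ->
  (forall k, (P (F k) <= (c * q ^+ k)%:E)%E) ->
  {ae P, forall w, exists N, forall k, (N <= k)%N -> ~ F k w}.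
Proof.
move=> mF c0 q0 q1 PF; exists (lim_sup_set F); split.
- by apply: bigcap_measurableType => i _; apply: bigcup_measurable => j _.
- apply: lim_sup_set_cvg0 => //.
  apply: (@le_lt_trans _ _ (c / (1 - q))%:E); last exact: ltry.
  apply: lime_le; first exact: is_cvg_nneseries.
  apply: nearW => N;
    apply: (@le_trans _ _ (\sum_(0 <= k < N) (c * q ^+ k)%:E)%E).
    by apply: lee_sum => k _; exact: PF.
  rewrite sumEFin lee_fin.
  have -> : \sum_(0 <= k < N) c * q ^+ k = series (geometric c q) N by [].
  rewrite geometric_seriesE ?lt_eqF //= ler_pM2r ?invr_gt0 ?subr_gt0 //.
  by rewrite ler_piMr // gerBl exprn_ge0.
- move=> w /= notall N _; apply: contrapT => nF; apply: notall.
  by exists N => k Nk Fk; apply: nF; exists k.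
Qed.

End almost_sure_convergence.

(** * The limit of sqrt(n) D_n, given that of the norm of the estimator *)

Section deviation_limit.
Context {R : realType}.
Implicit Types x : R.

(** From ln x = 2 ln (sqrt x); this growth rate sends ln(2nd/alpha)/n to 0. *)
Lemma ln_le_sqrt x : 0 < x -> ln x <= 2 * Num.sqrt x.
Proof.
move=> x0; have s0 : 0 < Num.sqrt x by rewrite sqrtr_gt0.
rewrite -[in X in ln X](sqr_sqrtr (ltW x0)) lnXn // mulr2n.
by have := ln_sublinear s0; lra.
Qed.

(** With h = 1/n, sqrt(n) D_n is a continuous function of h, L, the norm S and g = ln(2nd/alpha)/n,
    whose limits are 0, ln(d/alpha), s and 0. Only the middle term survives. *)
Lemma deviation_bound_cvg n (alpha s : R) (x : nat -> 'M[R]_n.+1) :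
  0 < alpha < 1 ->
  (fun m => spectral_norm (paired_variance (m.+1).*2 x)) @ \oo --> s ->
  (fun m : nat => Num.sqrt (m.*2)%:R * deviation_bound alpha m.*2 x) @ \oo -->
  Num.sqrt (2 * ln (n.+1%:R / alpha) * s).
Proof.
(* The shift discards m = 0, where n = 0 and the divisions take default values. *)
move=> /andP[alpha0 alpha1] S_cvg; rewrite -cvg_shiftS.
pose h (m : nat) : R := 2^-1 * harmonic m.
have hE m : ((m.+1).*2)%:R^-1 = h m.
  by rewrite /h /harmonic -mul2n natrM invfM.
have h0 m : 0 < h m by rewrite -hE invr_gt0 ltr0n.
have h_cvg : h @ \oo --> (0 : R).
  by rewrite -[X in _ --> X](mulr0 2^-1); apply: cvgMr; exact: cvg_harmonic.
pose a : R := n.+1%:R / alpha.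
have a1 : 1 < a by rewrite ltr_pdivlMr // mul1r (lt_le_trans alpha1) // ler1n.
pose L (m : nat) := ln (a * (1 - h m)^-1).
pose g (m : nat) := h m * ln (2 * a / h m).
set S := fun m : nat => spectral_norm (paired_variance (m.+1).*2 x) in S_cvg *.
have h_half m : h m <= 2^-1.
  by rewrite -hE lef_pV2 ?posrE // -[2]/(2%:R) ler_nat doubleS.
have L0 m : 0 <= L m.
  apply: ln_ge0; have h1 : 0 < 1 - h m by have := h_half m; lra.
  by rewrite ler_pdivlMr // mul1r; have := h0 m; lra.
have g0 m : 0 <= g m.
  apply: mulr_ge0; [exact: ltW|apply: ln_ge0].
  rewrite ler_pdivlMr // mul1r.
  by have := h_half m; lra.
have -> : (fun m => Num.sqrt ((m.+1).*2)%:R * deviation_bound alpha (m.+1).*2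
  x) =
    (fun m => L m / 3 * Num.sqrt (h m) + Num.sqrt (2 * S m * L m) +
      (Num.sqrt (5 / 3) + 1) * Num.sqrt (L m * g m)).
  apply/funext => m; rewrite /deviation_bound -/(S m).
  set N : R := ((m.+1).*2)%:R.
  have N2 : 2 <= N by rewrite ler_nat doubleS.
  have N0 : 0 < N by lra.
  have NE : N = (h m)^-1 by rewrite -hE invrK.
  have LE : ln (N * n.+1%:R / ((N - 1) * alpha)) = L m.
    congr ln; rewrite -hE -/N /a; field.
    by rewrite !gt_eqF //; lra.
  have gE : g m = ln (2 * N * n.+1%:R / alpha) / N.
    rewrite /g -hE -/N mulrC invrK; congr (ln _ / _).
    by rewrite /a; field; rewrite gt_eqF.
  rewrite LE; set l3 := ln _ in gE *.
  have sN0 : 0 < Num.sqrt N by rewrite sqrtr_gt0.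
  have sN2 : Num.sqrt N ^+ 2 = N by rewrite sqr_sqrtr // ltW.
  have shE : Num.sqrt (h m) = (Num.sqrt N)^-1 by rewrite -hE sqrtrV // ltW.
  rewrite [LHS]mulrDr [X in X + _ = _]mulrDr; congr (_ + _ + _).
  - rewrite shE; move: (Num.sqrt N) sN0 sN2 => r r0 <-.
    by field; rewrite gt_eqF.
  - rewrite -sqrtrM ?ltW //; congr Num.sqrt.
    by rewrite mulrC divfK // gt_eqF.
  - rewrite mulrCA; congr (_ * _); rewrite gE.
    have -> : L m * (l3 / N) = L m * l3 / N by rewrite mulrA.
    have Ll3 : 0 <= L m * l3.
      by have := mulr_ge0 (L0 m) (g0 m);
        rewrite gE mulrA pmulr_lge0 // invr_gt0.
    rewrite [RHS](sqrtrM _ Ll3) sqrtrV ?ltW //.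
    move: (Num.sqrt N) sN0 sN2 => r r0 <-.
    by field; rewrite gt_eqF.
have L_cvg : L @ \oo --> ln a.
  rewrite -[X in _ --> ln X]mulr1 -[X in _ --> ln (_ * X)]invr1.
  rewrite -[X in _ --> ln (_ * X^-1)]subr0.
  apply: continuous_cvg.
    by apply: continuous_ln; rewrite subr0 invr1 mulr1 (lt_trans ltr01).
  apply: cvgMr; apply: cvgV; first by rewrite subr0 oner_eq0.
  by apply: cvgB => //; exact: cvg_cst.
have g_cvg : g @ \oo --> (0 : R).
  apply: (@squeeze_cvgr _ _ _ _ (fun=> 0)
      (fun m => 2 * Num.sqrt (2 * a * h m))).
  - apply: nearW => m; rewrite g0 /=.
    have x0 : 0 < 2 * a / h m
        by rewrite divr_gt0 // mulr_gt0 // (lt_trans ltr01).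
    apply: (le_trans (ler_wpM2l (ltW (h0 m)) (ln_le_sqrt x0))).
    rewrite mulrCA ler_wpM2l //.
    have sh0 : 0 < Num.sqrt (h m) by rewrite sqrtr_gt0.
    have a20 : 0 <= 2 * a by lra.
    rewrite (sqrtrM (h m)^-1 a20) (sqrtrM (h m) a20) (sqrtrV (ltW (h0 m))).
    move: (Num.sqrt (h m)) sh0 (sqr_sqrtr (ltW (h0 m))) => r r0 <-.
    rewrite le_eqVlt; apply/orP; left; apply/eqP; field.
    by rewrite gt_eqF.
  - exact: cvg_cst.
  - have : (fun m => 2 * Num.sqrt (2 * a * h m)) @ \oo -->
        2 * Num.sqrt (2 * a * 0).
      apply: cvgMr; apply: continuous_cvg; first exact: sqrt_continuous.
      exact: cvgMr.
    by rewrite mulr0 sqrtr0 mulr0.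
have cvg1 : (fun m => L m / 3 * Num.sqrt (h m)) @ \oo --> ln a / 3 * Num.sqrt 0.
  apply: cvgM; first exact: cvgMl.
  by apply: continuous_cvg => //; exact: sqrt_continuous.
have cvg2 : (fun m => Num.sqrt (2 * S m * L m)) @ \oo -->
  Num.sqrt (2 * s * ln a).
  apply: continuous_cvg; first exact: sqrt_continuous.
  by apply: cvgM => //; exact: cvgMr.
have cvg3 : (fun m => (Num.sqrt (5 / 3) + 1) * Num.sqrt (L m * g m)) @ \oo -->
    (Num.sqrt (5 / 3) + 1) * Num.sqrt (ln a * 0).
  apply: cvgMr; apply: continuous_cvg; first exact: sqrt_continuous.
  exact: cvgM.
have -> : Num.sqrt (2 * ln (n.+1%:R / alpha) * s) =
    ln a / 3 * Num.sqrt 0 + Num.sqrt (2 * s * ln a) +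
    (Num.sqrt (5 / 3) + 1) * Num.sqrt (ln a * 0).
  by rewrite mulr0 sqrtr0 !mulr0 addr0 add0r -/a mulrAC.
by apply: cvgD => //; exact: cvgD.
Qed.

End deviation_limit.

(** * Strong consistency of the norm of the paired variance *)

Section paired_variance_consistency.
Context {R : realType} {disp : measure_display} {T : measurableType disp}.
Variables (P : probability T R) (n : nat) (X : nat -> T -> 'M[R]_n.+1).
Variables (M V : 'M[R]_n.+1).
Hypothesis sampleX : sample_hypotheses P [set: nat] X M V.

Lemma paired_deviation_ae s (e : R) : `|s| = 1 -> 0 < e -> e <= 1 ->
  {ae P, forall w, exists N, forall k, (N <= k)%N ->
    lambda_max (s *: (V - paired_variance (k.+1).*2 (X ^~ w))) < e}.
Proof.
move=> s1 e0 e1.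
(* A deviation of at least e in V_n^* means at least n e = 2 (k+1) e in the sum, so it implies F k
   with a factor 2 to spare. *)
pose F k := [set w | (k.+1)%:R * e <=
  lambda_max (partial_sum (paired_deviation X V s) k.+1 w)].
have symW k w : (s *: (V - paired_variance (k.+1).*2 (X ^~ w)))^T =
    s *: (V - paired_variance (k.+1).*2 (X ^~ w)).
  rewrite linearZ linearB /= (variance_sym sampleX (i := 0)) //.
  by rewrite (paired_variance_sym sampleX).
have psumE k w : lambda_max (partial_sum (paired_deviation X V s) k.+1 w) =
    ((k.+1).*2)%:R * lambda_max (s *: (V - paired_variance (k.+1).*2 (X ^~ w))).
  by rewrite partial_sum_paired // lambda_maxZ // ltr0n double_gt0.
pose q := expR (- (e ^+ 2 / 4)).
have q1 : q < 1 by rewrite expR_lt1 oppr_lt0 divr_gt0 // exprn_gt0.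
have := @ae_eventually_not _ _ _ P F n.+1%:R q.
move=> /(_ _ _ (expR_ge0 _) q1)[].
- move=> k; rewrite -[F k]setTI; apply: measurable_fun_le => //.
  under eq_fun do rewrite psumE; apply: measurable_funM;
    first exact: measurable_cst.
  exact: (measurable_paired_lambda_max sampleX).
- exact: ler0n.
- move=> k; apply: le_trans (paired_tail sampleX _ _ s1 e0 e1) _ => //.
  rewrite lee_fin ler_wpM2l // exprSr ler_piMr ?exprn_ge0 ?expR_ge0 //.
  exact: ltW.
move=> A [mA PA0 sub]; exists A; split => // w /= notN;
  apply: sub => /= -[N FN].
apply: notN; exists N => k /FN nF; rewrite ltNge; apply/negP => eW.
apply: nF; rewrite /F /= psumE.
have -> : (k.+1).*2%:R = 2 * k.+1%:R :> R by rewrite -mul2n natrM.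
have k0 : 0 <= k.+1%:R :> R by [].
move: (k.+1%:R) (lambda_max _) k0 eW => r l r0 el.
by have := ler_wpM2l r0 el; have := mulr_ge0 r0 (le_trans (ltW e0) el); lra.
Qed.

(** The thresholds 1/(j+1) are countably many, so one null set serves them all; the two signs bound
    the difference of norms from both sides through [spectral_norm_sub]. *)
Lemma paired_variance_norm_cvg : {ae P, forall w,
  (fun m => spectral_norm (paired_variance (m.+1).*2 (X ^~ w))) @ \oo -->
  spectral_norm V}.
Proof.
have ae_s s : `|s| = 1 -> {ae P, forall w, forall j : nat, exists N, forall k,
    (N <= k)%N -> lambda_max
      (s *: (V - paired_variance (k.+1).*2 (X ^~ w))) < j.+1%:R^-1}.
  move=> s1; apply: ae_foralln => j; apply: paired_deviation_ae => //.
  by rewrite invf_le1 // ler1n.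
apply: filterS2 (ae_s 1 (normr1 _)) (ae_s (-1) _) => [w h1 h2|]; last first.
  by rewrite normrN1.
apply/cvgrPdist_lt => e e0.
have [j _ /(_ j (leqnn _)) /= je] := near_infty_natSinv_lt (PosNum e0).
have [N1 H1] := h1 j; have [N2 H2] := h2 j.
exists (maxn N1 N2) => // k /=; rewrite geq_max => /andP[/H1 + /H2].
rewrite scale1r scaleN1r opprB => /lt_trans/(_ je) d1 /lt_trans/(_ je) d2.
have symV := variance_sym sampleX (I : [set: nat] 0%N).
have psdV := variance_psd sampleX (I : [set: nat] 0%N).
have symW := paired_variance_sym sampleX (m := k.+1) (fun _ _ => I) w.
have psdW := paired_variance_psd sampleX (m := k.+1) (fun _ _ => I) w.
set W := paired_variance _ _ in d1 d2 symW psdW *.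
have := spectral_norm_sub symV symW psdV;
  have := spectral_norm_sub symW symV psdW.
move: (spectral_norm V) (spectral_norm W) (lambda_max (V - W)) d1
  (lambda_max (W - V)) d2 => a b c ce c' ce' hW hV.
by rewrite ltr_norml; apply/andP; split; lra.
Qed.

End paired_variance_consistency.

Unset Implicit Arguments.

Theorem theorem3p1 (R : realType) (disp : measure_display)
    (T : measurableType disp) (P : probability T R)
    (d : nat) (hd : (0 < d)%N) (alpha : R) (halpha : 0 < alpha < 1)
    (M V : 'M[R]_d) (X : nat -> T -> 'M[R]_d) :
  (forall n : nat, (2 <= n)%N -> ~~ odd n ->
     sample_hypotheses P `I_n X M V ->
     (P [set w | (lambda_max (sample_average n (fun i => X i w) - M)
                  >= deviation_bound alpha n (fun i => X i w))%R]
      <= alpha%:E)%E)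
  /\
  (sample_hypotheses P [set: nat] X M V ->
   mx_identically_distributed P X ->
   {ae P, forall w,
     (fun m : nat =>
        Num.sqrt (m.*2)%:R * deviation_bound alpha m.*2 (fun i => X i w))
     @ \oo --> Num.sqrt (2 * ln (d%:R / alpha) * spectral_norm V)}).
Proof.
case: d hd M V X => [//|d] _ M V X; split=> [n n2 evn sampleX|sampleX _].
  have nE : n = n./2.*2 by rewrite -[LHS]odd_double_half (negbTE evn).
  rewrite nE in n2 sampleX *.
  apply: (finite_sample_bound sampleX) => //.
  by rewrite -double_gt0 ltnW.
apply: filterS (paired_variance_norm_cvg sampleX) => w norm_cvg.
exact: deviation_bound_cvg.
Qed.
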